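(* Let $\varrho=(r_n)_{n\in\mathbb{N}}$ be an increasing sequence in $[0,1)$ converging to $1$. There exist two functions $f_1,f_2\in H(\mathbb{D})$ such that the family $\{f_1,f_2\}$ is $\varrho$-Abel multi-universal but neither $f_1$ nor $f_2$ is $\varrho$-Abel universal. Respectively, there exist two functions $f_1,f_2\in H(\mathbb{D})$ such that the family $\{f_1,f_2\}$ is Abel multi-universal but neither $f_1$ nor $f_2$ is Abel universal.
   Context: $\mathbb{D}$ is the open unit disc of $\mathbb{C}$, $\mathbb{T}$ the unit circle, $H(\mathbb{D})$ the space of holomorphic functions on $\mathbb{D}$, and $\mathcal{C}(K)$ the space of continuous complex functions on a compact set $K$ with the uniform norm. - A finite set $\{f_1,\dots,f_l\}\subset H(\mathbb{D})$ is $\varrho$-Abel multi-universal if for every compact $K\subset\mathbb{T}$ with $K\neq\mathbb{T}$ the set $\bigcup_{i=1}^l\{z\mapsto f_i(r_nz)|_K:n\in\mathbb{N}\}$ is dense in $\mathcal{C}(K)$ (equivalently: for every such $K$ and every $h\in\mathcal{C}(\mathbb{T})$ there are $i\in\{1,\dots,l\}$ and an increasing sequence $(\lambda_n)_n\subset\mathbb{N}$ with $\sup_{z\in K}|f_i(r_{\lambda_n}z)-h(z)|\to0$). - A finite set $\{f_1,\dots,f_l\}\subset H(\mathbb{D})$ is Abel multi-universal if for every compact $K\subset\mathbb{T}$ with $K\neq\mathbb{T}$ and every $h\in\mathcal{C}(\mathbb{T})$ there are $i\in\{1,\dots,l\}$ and an increasing sequence $(\rho_n)_n$ of positive real numbers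 tending to $1$ (with $\rho_n<1$) such that $\sup_{z\in K}|f_i(\rho_nz)-h(z)|\to0$. - $f\in H(\mathbb{D})$ is $\varrho$-Abel universal if for every compact $K\subset\mathbb{T}$ with $K\neq\mathbb{T}$ the set $\{z\mapsto f(r_nz)|_K:n\in\mathbb{N}\}$ is dense in $\mathcal{C}(K)$. - $f\in H(\mathbb{D})$ is Abel universal if for every compact $K\subset\mathbb{T}$ with $K\neq\mathbb{T}$ and every $h\in\mathcal{C}(K)$ there is a sequence $(\rho_n)_n$ in $[0,1)$ tending to $1$ with $\sup_{\zeta\in K}|f(\rho_n\zeta)-h(\zeta)|\to0$. *)

(* Defs.v *)
From HB Require Import structures.
From mathcomp Require Import all_boot all_order all_algebra.
From mathcomp Require Import complex.
From mathcomp Require Import all_classical all_reals all_analysis.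

Set Implicit Arguments.
Unset Strict Implicit.
Unset Printing Implicit Defensive.

Import Order.TTheory GRing.Theory Num.Theory.
Import numFieldNormedType.Exports.

Local Open Scope classical_set_scope.
Local Open Scope ring_scope.
Local Open Scope complex_scope.

(* The regular module R[i]^o carries the norm, the topology and the uniform
   structure given by the modulus; its scalars are the complex numbers, so that
   derivable f z 1 below is complex differentiability at z. *)
Notation Cplx R := ((R[i])^o).

Definition unit_disc (R : realType) : set (Cplx R) := [set z | `|z| < 1].

Definition unit_circle (R : realType) : set (Cplx R) := [set z | `|z| = 1].

(* Functions on a subset of the plane are represented by total functions whose
   values outside that subset are irrelevant. *)
Definition holomorphic_disc (R : realType) : set (Cplx R -> Cplx R) :=
  [set f | forall z : Cplx R, unit_disc z -> derivable f z 1].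

Definition proper_compact (R : realType) (K : set (Cplx R)) : Prop :=
  [/\ compact K, K `<=` @unit_circle R & K <> @unit_circle R].

Definition dilate (R : realType) (f : Cplx R -> Cplx R) (s : R) :
    Cplx R -> Cplx R :=
  fun z => f (s%:C * z).

(* {uniform` K -> V} is the space of total functions with the topology of
   uniform convergence on K: S is dense in C(K) when each function continuous
   on K is in the closure of S for that topology. *)
Definition dense_continuous (R : realType) (K : set (Cplx R))
    (S : set (Cplx R -> Cplx R)) : Prop :=
  [set h : Cplx R -> Cplx R | {within K, continuous h}]
    `<=` closure (S : set {uniform` K -> Cplx R}).

Definition rho_abel_multi_universal (R : realType) (r : nat -> R)
    (F : set (Cplx R -> Cplx R)) : Prop :=
  forall K : set (Cplx R), proper_compact K ->
    dense_continuous K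
      (\bigcup_(f in F) [set dilate f (r n) | n in [set: nat]]).

Definition rho_abel_universal (R : realType) (r : nat -> R)
    (f : Cplx R -> Cplx R) : Prop :=
  forall K : set (Cplx R), proper_compact K ->
    dense_continuous K [set dilate f (r n) | n in [set: nat]].

Definition abel_multi_universal (R : realType)
    (F : set (Cplx R -> Cplx R)) : Prop :=
  forall (K : set (Cplx R)) (h : Cplx R -> Cplx R),
    proper_compact K -> {within @unit_circle R, continuous h} ->
    exists2 f, F f & exists rho : nat -> R,
      [/\ increasing_seq rho,
          (forall n, 0 < rho n < 1),
          rho @ \oo --> (1 : R) &
          {uniform K, (fun n => dilate f (rho n)) @ \oo --> h}].

Definition abel_universal (R : realType) (f : Cplx R -> Cplx R) : Prop :=
  forall (K : set (Cplx R)) (h : Cplx R -> Cplx R),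
    proper_compact K -> {within K, continuous h} ->
    exists rho : nat -> R,
      [/\ (forall n, 0 <= rho n < 1),
          rho @ \oo --> (1 : R) &
          {uniform K, (fun n => dilate f (rho n)) @ \oo --> h}].

(* Main.v *)
Require Import Defs.
From HB Require Import structures.
From mathcomp Require Import all_boot all_order all_algebra.
From mathcomp Require Import complex.
From mathcomp Require Import ring lra zify.
From mathcomp Require Import cyclic separable cyclotomic.
From mathcomp Require Import all_classical all_reals all_analysis.
Set Implicit Arguments.
Unset Strict Implicit.
Unset Printing Implicit Defensive.
Import Order.TTheory GRing.Theory Num.Theory.
Import numFieldNormedType.Exports.
Local Open Scope classical_set_scope.
Local Open Scope ring_scope.
Local Open Scope complex_scope.

Local Notation Re := complex.Re.
Local Notation Im := complex.Im.

(** One function carries both parts. The construction yields [f] holomorphic in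
    the disc with [Re f >= -2] on the radius ending at 1, such that, for each
    polynomial [p] with [Re p(1) >= 0] and each proper compact subset [K] of the
    circle, some dilate [f (r m * _)] with [m] arbitrarily large is close to [p]
    on [K] ([universal_function]). Because of the bound on the radius, the
    dilates of [f] stay away from [-3] at the point 1, and those of [-f] from 3,
    so neither function is universal, already for [K = {1}]. On the other hand,
    polynomials are dense in [C(K)], and each polynomial [p] satisfies
    [Re p(1) >= 0] or [Re (-p)(1) >= 0]; hence [f] approximates [p], or [-f]
    does. This gives the density of the union of the two families of dilates. If
    [f] fails to approximate a given [h] at some accuracy, then [-f] succeeds at
    all accuracies, which gives the version with sequences.

    The function [f] is the limit of polynomials [S n], where
    [S (n+1) = S n + u * (p - S n)] for a polynomial cutoff [u] which is small on
    a large disc, close to 1 on a larger circle deprived of a small arc, and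
    almost takes values in the unit interval on the radius ending at 1
    ([cutoff]). On this radius [S (n+1)] is therefore almost a convex
    combination of [S n] and [p], so the lower bound of the real part survives
    ([approximation_step]). The cutoff is a polynomial approximation of
    [1 - b^N / (z^N + b^N)] for [N] large: this function has the required
    properties, and none of its poles lies on the positive axis. They can thus
    be pushed to infinity, first along the circle of radius [b], then through the
    missing arc ([lollipop_pole]), which is Runge's argument.

    The density of polynomials in [C(K)] comes from a discrete convolution with
    the de la Vallee-Poussin kernel [|(1 + y) / 2|^(2n)] over roots of unity
    ([kernel_approximation]), together with the approximation of [1/z] by pole
    pushing. The holomorphy of the limit of [S n] comes from Cauchy estimates for
    polynomials, again obtained by averaging over roots of unity
    ([poly_tangent], [poly_limit_holomorphic]). *)

(** * The modulus as a real number *)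

(** The norm on [R[i]] takes values in [R[i]]; [modulus] is its real value, so
    that estimates take place in the ordered field [R]. *)
Definition modulus {R : realType} (z : R[i]) : R := ComplexField.Normc.normc z.

Section Modulus.
Variable R : realType.
Implicit Types (x y : R) (z w : R[i]).

Lemma normE z : `|z| = (modulus z)%:C.
Proof. by rewrite normc_def; case: z. Qed.

Lemma modulusM z w : modulus (z * w) = modulus z * modulus w.
Proof. exact: ComplexField.Normc.normcM. Qed.

Lemma modulusV z : modulus z^-1 = (modulus z)^-1.
Proof. exact: ComplexField.Normc.normcV. Qed.

Lemma modulus_ge0 z : 0 <= modulus z.
Proof. by case: z => a b; rewrite /modulus /= sqrtr_ge0. Qed.

Lemma modulusN z : modulus (- z) = modulus z.
Proof. by apply: complexI; rewrite /= -!normE normrN. Qed.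

Lemma modulusB z w : modulus (z - w) = modulus (w - z).
Proof. by rewrite -modulusN opprB. Qed.

Lemma modulusD z w : modulus (z + w) <= modulus z + modulus w.
Proof. by rewrite -lecR rmorphD/= -!normE ler_normD. Qed.

Lemma modulus_triangle z w v : modulus (z - v) <= modulus (z - w) + modulus (w - v).
Proof. by rewrite -[z - v](subrKA w) modulusD. Qed.

Lemma modulus_sub_ge z w : modulus z - modulus w <= modulus (z - w).
Proof. by rewrite lerBlDr -[in leLHS](subrK w z) modulusD. Qed.

Lemma modulus_add_ge z w : modulus z - modulus w <= modulus (z + w).
Proof. by rewrite -(modulusN w) -{2}[w]opprK modulus_sub_ge. Qed.

Lemma modulus0 : modulus (0 : R[i]) = 0.
Proof. exact: ComplexField.Normc.normc0. Qed.

Lemma modulus1 : modulus (1 : R[i]) = 1.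
Proof. exact: ComplexField.Normc.normc1. Qed.

Lemma modulus_eq0 z : (modulus z == 0) = (z == 0).
Proof. by rewrite -(inj_eq (@complexI R)) -normE normr_eq0. Qed.

Lemma modulus_gt0 z : (0 < modulus z) = (z != 0).
Proof. by rewrite lt0r modulus_ge0 andbT modulus_eq0. Qed.

Lemma modulusX z n : modulus (z ^+ n) = modulus z ^+ n.
Proof.
by elim: n => [|n IHn]; rewrite ?expr0 ?modulus1// !exprS modulusM IHn.
Qed.

Lemma modulus_real x : modulus x%:C = `|x|.
Proof. by rewrite /modulus /= expr0n /= addr0 sqrtr_sqr. Qed.

Lemma modulus_nat n : modulus (n%:R : R[i]) = n%:R.
Proof. by rewrite -(rmorph_nat (real_complex R)) modulus_real normr_nat. Qed.

Lemma modulus_sum (I : Type) (s : seq I) (P : pred I) (F : I -> R[i]) :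
  modulus (\sum_(i <- s | P i) F i) <= \sum_(i <- s | P i) modulus (F i).
Proof.
elim/big_ind2 : _ => [||//]; first by rewrite modulus0.
by move=> a b c d ab cd; apply: le_trans (modulusD _ _) (lerD ab cd).
Qed.

Lemma modulus_sq z : (modulus z) ^+ 2 = Re z ^+ 2 + Im z ^+ 2.
Proof. by case: z => a b; rewrite /modulus /= sqr_sqrtr// addr_ge0// sqr_ge0. Qed.

Lemma Re_le_modulus z : `|Re z| <= modulus z.
Proof.
by rewrite -(@ler_pXn2r _ 2)// ?nnegrE ?modulus_ge0// modulus_sq real_normK ?num_real// lerDl sqr_ge0.
Qed.

Lemma Im_le_modulus z : `|Im z| <= modulus z.
Proof.
by rewrite -(@ler_pXn2r _ 2)// ?nnegrE ?modulus_ge0// modulus_sq real_normK ?num_real// lerDr sqr_ge0.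
Qed.

Lemma modulus_le_ReIm z : modulus z <= `|Re z| + `|Im z|.
Proof.
rewrite -(@ler_pXn2r _ 2)// ?nnegrE ?modulus_ge0 ?addr_ge0// modulus_sq.
by rewrite sqrrD !real_normK ?num_real// lerD2r lerDl mulrn_wge0// mulr_ge0.
Qed.

Lemma complex_ReD z w : Re (z + w) = Re z + Re w.
Proof. by case: z; case: w. Qed.

Lemma complex_ReN z : Re (- z) = - Re z.
Proof. by case: z. Qed.

Lemma complex_ReMl x z : Re (x%:C * z) = x * Re z.
Proof. by case: z => a b /=; rewrite mul0r subr0. Qed.

End Modulus.

(** * Roots of unity and coefficients of polynomials *)

Section Coefficients.
Variable R : realType.
Implicit Types (x y : R) (z w : R[i]).

Lemma prim_root_exists n : (0 < n)%N -> exists e : R[i], n.-primitive_root e.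
Proof.
move=> n_gt0; pose p : {poly R[i]} := 'X^n - 1.
have [r Dp] := closed_field_poly_normal p.
move: Dp; rewrite (monicP _) ?monicXnsubC // scale1r => Dp.
have rn1 : all n.-unity_root r by apply/allP=> z; rewrite -root_prod_XsubC -Dp.
have sz_r : (n < (size r).+1)%N.
  by rewrite -(size_prod_XsubC r id) -Dp size_XnsubC.
have [|z] := hasP (has_prim_root n_gt0 rn1 _ sz_r); last by exists z.
by rewrite -separable_prod_XsubC -Dp separable_Xn_sub_1 // pnatr_eq0 -lt0n.
Qed.

Lemma modulus_unity_root n (e : R[i]) : (0 < n)%N -> e ^+ n = 1 -> modulus e = 1.
Proof.
move=> n0 en; have : modulus e ^+ n = 1 by rewrite -modulusX en modulus1.
by move/eqP; rewrite pexpr_eq1// ?modulus_ge0// => /eqP.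
Qed.

(** Averaging over the [n]-th roots of unity extracts one coefficient. *)
Lemma coef_unity_root_sum n (e : R[i]) (p : {poly R[i]}) (y : R[i]) k :
  n.-primitive_root e -> (size p <= n)%N -> (k < n)%N -> y != 0 ->
  \sum_(j < n) p.[y * e ^+ j] * (y * e ^+ j) ^- k = n%:R * p`_k.
Proof.
move=> prim sz kn y0.
have n0 : (0 < n)%N by apply: leq_trans kn.
have e0 : e != 0.
  by rewrite -modulus_eq0 (modulus_unity_root n0 (prim_expr_order prim)) oner_eq0.
under eq_bigr => j _ do rewrite (horner_coef_wide _ sz) big_distrl/=.
rewrite exchange_big /= (bigD1 (Ordinal kn))//= [X in _ + X]big1 ?addr0.
  under eq_bigr => j _ do rewrite mulfK ?expf_eq0 ?mulf_eq0 ?expf_eq0 ?(negbTE y0) ?(negbTE e0) ?andbF//.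
  by rewrite sumr_const card_ord mulr_natl.
move=> i ik.
pose q := e ^+ i / e ^+ k.
have q1 : q != 1.
  apply/eqP; rewrite /q => /divr1_eq/eqP; rewrite (eq_prim_root_expr prim) !modn_small// => ki.
  by move/eqP: ik; apply; apply/val_inj/eqP.
rewrite (eq_bigr (fun j : 'I_n => p`_i * (y ^+ i / y ^+ k) * q ^+ j)); last first.
  move=> j _; rewrite /q !exprMn invfM exprVn -!exprM [(i * j)%N]mulnC [(k * j)%N]mulnC.
  by ring.
rewrite -big_distrr/=.
suff -> : \sum_(j < n) q ^+ j = 0 by rewrite mulr0.
have qn : q ^+ n = 1.
  by rewrite /q exprMn exprVn -!exprM ![(_ * n)%N]mulnC !exprM (prim_expr_order prim) !expr1n invr1 mulr1.
have /esym/eqP := subrX1 q n; rewrite qn subrr mulf_eq0 subr_eq0 (negbTE q1) /=.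
by move/eqP.
Qed.

(** Cauchy's estimate for the coefficients. *)
Lemma coef_le_circle (p : {poly R[i]}) rho B k : 0 < rho ->
  (forall z, modulus z = rho -> modulus p.[z] <= B) ->
  modulus p`_k * rho ^+ k <= B.
Proof.
move=> rho0 pB; have B0 : 0 <= B.
  by apply: le_trans (pB rho%:C _); rewrite ?modulus_ge0// modulus_real gtr0_norm.
have [szk|ksz] := leqP (size p) k; first by rewrite nth_default// modulus0 mul0r.
have n0 : (0 < size p)%N by apply: leq_trans ksz.
have [e prim] := prim_root_exists n0.
have rC0 : rho%:C != 0 :> R[i] by rewrite -modulus_eq0 modulus_real gtr0_norm// gt_eqF.
have := coef_unity_root_sum prim (leqnn _) ksz rC0.
move/(congr1 modulus); rewrite modulusM modulus_nat => eqs.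
have me j : modulus (rho%:C * e ^+ j) = rho.
  rewrite modulusM modulusX (modulus_unity_root n0 (prim_expr_order prim)).
  by rewrite expr1n mulr1 modulus_real gtr0_norm.
rewrite -(@ler_pM2l _ (size p)%:R) ?ltr0n// mulrA -eqs -ler_pdivlMr ?exprn_gt0//.
apply: le_trans (modulus_sum _ _ _) _.
apply: (@le_trans _ _ (\sum_(j < size p) (B / rho ^+ k))).
  apply: ler_sum => j _; rewrite modulusM modulusV modulusX me.
  by apply: ler_wpM2r; [rewrite invr_ge0 exprn_ge0 ?ltW | exact/pB/me].
by rewrite sumr_const card_ord -mulrA mulr_natl.
Qed.

Lemma geometric_sum_le (x : R) n : 0 <= x < 1 -> \sum_(i < n) x ^+ i <= (1 - x)^-1.
Proof.
move=> /andP[x0 x1]; rewrite -[leRHS]mul1r ler_pdivlMr ?subr_gt0// mulrC.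
rewrite -(opprB x) mulNr -subrX1 opprB lerBlDr lerDl exprn_ge0//.
Qed.

(** A weak form of the maximum principle, which suffices for local bounds. *)
Lemma horner_le_circle (p : {poly R[i]}) rho B z : modulus z < rho ->
  (forall z, modulus z = rho -> modulus p.[z] <= B) ->
  modulus p.[z] <= B / (1 - modulus z / rho).
Proof.
move=> zr pB; have rho0 : 0 < rho by apply: le_lt_trans zr; exact: modulus_ge0.
have B0 : 0 <= B.
  by apply: le_trans (pB rho%:C _); rewrite ?modulus_ge0// modulus_real gtr0_norm.
rewrite horner_coef; apply: le_trans (modulus_sum _ _ _) _.
apply: (@le_trans _ _ (\sum_(i < size p) B * (modulus z / rho) ^+ i)).
  apply: ler_sum => i _; rewrite modulusM modulusX exprMn exprVn [_ * (_ ^+ _)^-1]mulrC mulrA.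
  rewrite ler_wpM2r ?exprn_ge0 ?modulus_ge0// ler_pdivlMr ?exprn_gt0//.
  exact: coef_le_circle.
rewrite -big_distrr/= ler_wpM2l// geometric_sum_le// divr_ge0 ?modulus_ge0 ?ltW//=.
by rewrite ltr_pdivrMr// mul1r.
Qed.

(** The divided difference of a polynomial is a polynomial, which is bounded
    inside the disc through its values on the circle. *)
Lemma divided_difference (p : {poly R[i]}) rho s B z0 : 0 <= s < rho ->
  modulus z0 <= s -> modulus p.[z0] <= B ->
  (forall z, modulus z = rho -> modulus p.[z] <= B) ->
  exists2 q : {poly R[i]}, (forall z, p.[z] - p.[z0] = q.[z] * (z - z0)) &
    forall z, modulus z <= s \/ modulus z = rho ->
      modulus q.[z] <= 2 / (rho - s) / (1 - s / rho) * B.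
Proof.
move=> /andP[s0 sr] z0s pz0 pB.
have rho0 : 0 < rho by apply: le_lt_trans sr.
have B0 : 0 <= B by apply: le_trans pz0; exact: modulus_ge0.
have sr1 : 0 < 1 - s / rho by rewrite subr_gt0 ltr_pdivrMr// mul1r.
have sr_le1 : 1 - s / rho <= 1 by rewrite gerBl divr_ge0// ltW.
have [q pq] : exists q, p - p.[z0]%:P = q * ('X - z0%:P).
  by apply/factor_theorem; rewrite /root !hornerE subrr.
exists q => [z|z].
  by have := congr1 (fun r : {poly R[i]} => r.[z]) pq; rewrite !hornerE.
have qz v : p.[v] - p.[z0] = q.[v] * (v - z0).
  by have := congr1 (fun r : {poly R[i]} => r.[v]) pq; rewrite !hornerE.
have qB v : modulus v = rho -> modulus q.[v] <= 2 * B / (rho - s).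
  move=> vr; rewrite ler_pdivlMr ?subr_gt0//.
  have vz : rho - s <= modulus (v - z0).
    by apply: le_trans (modulus_sub_ge _ _); rewrite vr lerD2l lerN2.
  apply: le_trans (ler_wpM2l (modulus_ge0 _) vz) _.
  rewrite -modulusM -qz (le_trans (modulusD _ _))// modulusN mulr_natl mulr2n.
  by rewrite lerD// pB.
have c0 : 0 <= 2 * B / (rho - s) by rewrite divr_ge0 ?mulr_ge0 ?subr_ge0// ltW.
rewrite (_ : _ * B = 2 * B / (rho - s) / (1 - s / rho)); last by ring.
case=> [zs|zr]; last first.
  by apply: le_trans (qB _ zr) _; rewrite ler_peMr// invf_ge1.
have zr : modulus z < rho by apply: le_lt_trans sr.
apply: le_trans (horner_le_circle zr qB) _.
apply: ler_wpM2l => //; rewrite lef_pV2 ?posrE ?subr_gt0 ?ltr_pdivrMr ?mul1r//.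
by rewrite lerD2l lerN2 ler_wpM2r// invr_ge0 ltW.
Qed.

(** On a smaller disc, a polynomial is quadratically close to its tangent, with
    a constant that does not depend on the degree. *)
Lemma poly_tangent rho s : 0 <= s < rho ->
  exists2 C, 0 <= C & forall (p : {poly R[i]}) B z0, modulus z0 <= s ->
    (forall z, modulus z <= rho -> modulus p.[z] <= B) ->
    exists2 g, modulus g <= C * B & forall z, modulus z <= s ->
      modulus (p.[z] - p.[z0] - g * (z - z0)) <= C * B * modulus (z - z0) ^+ 2.
Proof.
move=> srho; have /andP[s0 sr] := srho.
pose D := 2 / (rho - s) / (1 - s / rho).
have rho0 : 0 < rho by apply: le_lt_trans sr.
have D0 : 0 <= D.
  rewrite /D !divr_ge0 ?subr_ge0//; first exact: ltW.
  by rewrite ler_pdivrMr// mul1r ltW.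
exists (D + D ^+ 2) => [|p B z0 z0s pB]; first by rewrite addr_ge0// sqr_ge0.
have z0r : modulus z0 <= rho by apply: le_trans z0s (ltW sr).
have B0 : 0 <= B by apply: le_trans (pB _ z0r); exact: modulus_ge0.
have [z zr|q pq qB] := divided_difference srho z0s (pB _ z0r); first by apply: pB; rewrite zr.
have [z zr|t qt tB] := divided_difference srho z0s (qB z0 (or_introl z0s)).
  by apply: qB; right.
exists q.[z0] => [|z zs].
  by apply: le_trans (qB _ (or_introl z0s)) _; rewrite ler_wpM2r// lerDl sqr_ge0.
rewrite pq -mulrBl qt -[_ * _ * (z - z0)]mulrA -expr2 modulusM modulusX.
rewrite ler_wpM2r ?exprn_ge0 ?modulus_ge0//.
apply: le_trans (tB _ (or_introl zs)) _.
by rewrite -/D mulrA -expr2 ler_wpM2r// lerDr.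
Qed.

End Coefficients.

(** * Locally uniform limits of polynomials *)

Section Limits.
Variable R : realType.
Implicit Types (x y c : R) (z w : R[i]).

Lemma le_half_powers x y c : (forall k, x <= y + c / 2 ^+ k) -> x <= y.
Proof.
move=> H; apply/ler_addgt0Pr => e e0.
have ce0 : 0 <= `|c| / e by rewrite divr_ge0// ltW.
pose k := Num.bound (`|c| / e); apply: le_trans (H k) _; rewrite lerD2l.
rewrite ler_pdivrMr ?exprn_gt0// (le_trans (ler_norm c))//.
rewrite mulrC -ler_pdivrMr// (le_trans (ltW (archi_boundP ce0)))//.
by rewrite -natrX ler_nat ltnW// ltn_expl.
Qed.

(** The limit is the supremum of the lower bounds [u n - c / 2 ^+ n], which
    increase with [n]. *)
Lemma real_geometric_limit (u : nat -> R) c :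
  (forall n, `|u n.+1 - u n| <= c / 2 ^+ n.+1) ->
  exists l, forall n, `|u n - l| <= c / 2 ^+ n.
Proof.
move=> uc.
have half n : c / 2 ^+ n = c / 2 ^+ n.+1 + c / 2 ^+ n.+1.
  by rewrite exprS invfM; field.
have c0 n : 0 <= c / 2 ^+ n.
  rewrite half; have := le_trans (normr_ge0 _) (uc n); lra.
pose lo n := u n - c / 2 ^+ n; pose hi n := u n + c / 2 ^+ n.
have loS n : lo n <= lo n.+1.
  by rewrite /lo (half n); have := uc n; rewrite ler_norml => /andP[]; lra.
have hiS n : hi n.+1 <= hi n.
  by rewrite /hi (half n); have := uc n; rewrite ler_norml => /andP[]; lra.
have lohi n m : lo n <= hi m.
  have /nondecreasing_seqP lo_mono := loS; have /nonincreasing_seqP hi_mono := hiS.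
  apply: (le_trans (lo_mono n (maxn n m) (leq_maxl _ _))).
  apply: le_trans (hi_mono m (maxn n m) (leq_maxr _ _)).
  by rewrite /lo /hi; have := c0 (maxn n m); lra.
have lo_sup : has_sup (range lo).
  by split; [exists (lo 0%N), 0%N | exists (hi 0%N) => _ [n _ <-]].
exists (sup (range lo)) => n.
have l1 : lo n <= sup (range lo) by apply: ub_le_sup; [exact: lo_sup.2 | exists n].
have l2 : sup (range lo) <= hi n.
  by apply: ge_sup; [exact: lo_sup.1 | move=> _ [m _ <-]].
by rewrite ler_norml; move: l1 l2; rewrite /lo /hi; lra.
Qed.

Lemma geometric_limit (u : nat -> R[i]) c :
  (forall n, modulus (u n.+1 - u n) <= c / 2 ^+ n.+1) ->
  exists l, forall n, modulus (u n - l) <= 2 * (c / 2 ^+ n).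
Proof.
move=> uc.
have [n|a ua] := @real_geometric_limit (fun n => Re (u n)) c.
  by rewrite -complex_ReN -complex_ReD; apply: le_trans (Re_le_modulus _) (uc n).
have [n|b ub] := @real_geometric_limit (fun n => Im (u n)) c.
  apply: le_trans (uc n); apply: le_trans (Im_le_modulus _).
  by case: (u n.+1); case: (u n).
exists (a +i* b) => n; apply: le_trans (modulus_le_ReIm _) _.
have := ua n; have := ub n; case: (u n) => v w /= ? ?.
by rewrite mulr_natl mulr2n lerD.
Qed.

Lemma poly_bounded (p : {poly R[i]}) rho :
  exists2 B, 0 <= B & forall z, modulus z <= rho -> modulus p.[z] <= B.
Proof.
elim/poly_ind : p => [|p c [B B0 pB]].
  by exists 0 => // z _; rewrite horner0 modulus0.
exists (B * `|rho| + modulus c) => [|z zr].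
  by rewrite addr_ge0 ?mulr_ge0 ?modulus_ge0.
rewrite !hornerE; apply: le_trans (modulusD _ _) _; rewrite lerD2r modulusM.
by rewrite ler_pM ?modulus_ge0 ?pB// (le_trans zr)// ler_norm.
Qed.

(** A quadratic bound on the distance to a tangent yields the derivative. *)
Lemma derivable_of_tangent (f : Cplx R -> Cplx R) (z g : R[i]) c (d : R) : 0 < d ->
  (forall w, modulus (w - z) < d ->
    modulus (f w - f z - g * (w - z)) <= c * modulus (w - z) ^+ 2) ->
  derivable f z 1.
Proof.
move=> d0 fg; apply/cvg_ex; exists (g : Cplx R).
apply/cvgrPdist_le => /= e e0.
have eE : e = (Re e)%:C by rewrite RRe_real// gtr0_real.
have e1 : 0 < Re e by rewrite -ltcR -eE.
pose t := Num.min d (Re e / (`|c| + 1)).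
have t0 : 0 < t by rewrite lt_min d0 divr_gt0// ltr_pwDr.
exists t%:C => /=; first by rewrite ltcR.
move=> h /=; rewrite sub0r normrN normE ltcR => ht h0.
rewrite eE normE lecR.
have -> : h *: (1 : Cplx R) + z = h + z by rewrite /GRing.scale/= mulr1.
have htd : modulus h < d by apply: lt_le_trans ht _; rewrite ge_min lexx.
have := fg (h + z); rewrite addrK => /(_ htd) fgh.
have mh : 0 < modulus h by rewrite modulus_gt0.
rewrite -(ler_pM2r mh) -modulusM.
have -> : (g - h^-1 *: (f (h + z) - f z)) * h = - (f (h + z) - f z - g * h).
  by rewrite /GRing.scale/=; field.
rewrite modulusN; apply: le_trans fgh _; rewrite expr2 mulrA ler_wpM2r ?modulus_ge0//.
have ht2 : modulus h <= Re e / (`|c| + 1).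
  by apply: ltW; apply: lt_le_trans ht _; rewrite ge_min lexx orbT.
apply: (@le_trans _ _ ((`|c| + 1) * modulus h)).
  by rewrite ler_wpM2r ?modulus_ge0// (le_trans (ler_norm c))// lerDl.
by move: ht2; rewrite ler_pdivlMr ?ltr_pwDr// mulrC.
Qed.



(** A locally uniform limit of polynomials on the disc is holomorphic. At a
    given point, the tangents of the successive differences given by
    [poly_tangent] add up to the tangent of the limit. *)
Lemma poly_limit_holomorphic (S : nat -> {poly R[i]}) (a : nat -> R) :
  {homo a : m n / (m <= n)%N >-> m <= n} -> (forall x, x < 1 -> exists n, x < a n) ->
  (forall n z, modulus z <= a n -> modulus ((S n.+1).[z] - (S n).[z]) <= 1 / 2 ^+ n.+1) ->
  exists2 f : Cplx R -> Cplx R, holomorphic_disc f &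
    forall n z, modulus z <= a n -> modulus ((S n).[z] - f z) <= 2 / 2 ^+ n.
Proof.
move=> a_mono a1 SS.
have tail n z : modulus z <= a n -> exists l, forall k,
    modulus ((S (n + k)%N).[z] - l) <= 2 / 2 ^+ (n + k).
  move=> zn; have [k|l ul] := @geometric_limit (fun k => (S (n + k)%N).[z]) (1 / 2 ^+ n).
    rewrite addnS (le_trans (SS _ _ _))//; first by rewrite (le_trans zn)// a_mono// leq_addr.
    by rewrite -addnS exprD invfM mulrA.
  by exists l => k; apply: le_trans (ul k) _; rewrite exprD invfM; lra.
have lims z : exists l, forall n, modulus z <= a n -> modulus ((S n).[z] - l) <= 2 / 2 ^+ n.
  have [zn|nzn] := pselect (exists n, modulus z <= a n); last first.
    by exists 0 => n zn; case: nzn; exists n.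
  pose n0 := ex_minn zn; have zn0 : modulus z <= a n0 by rewrite /n0; case: ex_minnP.
  have [l ul] := tail n0 z zn0; exists l => n zan.
  have n0n : (n0 <= n)%N by rewrite /n0; case: ex_minnP => m _; apply.
  by have := ul (n - n0)%N; rewrite subnKC.
have [f fS] := choice lims; exists f; last by move=> n z; exact: fS.
move=> z0; rewrite /unit_disc /= normE ltcR => z01.
pose s := (modulus z0 + 1) / 2; pose rho := (s + 1) / 2.
have z0s : modulus z0 < s by rewrite /s; lra.
have srho : 0 <= s < rho.
  by have := modulus_ge0 z0; rewrite /rho /s; lra.
have [n0 an0] : exists n, rho < a n by apply: a1; rewrite /rho /s; lra.
have [C C0 tanC] := poly_tangent srho.
have [B B0 SB] := poly_bounded (S n0) rho.
have [g gB gP] := tanC (S n0) B z0 (ltW z0s) SB.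
have an k : rho <= a (n0 + k)%N by apply: (le_trans (ltW an0)); rewrite a_mono// leq_addr.
have step k : exists gk, modulus gk <= C / 2 ^+ k.+1 /\ (forall z, modulus z <= s ->
    modulus ((S (n0 + k).+1).[z] - (S (n0 + k)%N).[z]
      - ((S (n0 + k).+1).[z0] - (S (n0 + k)%N).[z0]) - gk * (z - z0))
      <= C / 2 ^+ k.+1 * modulus (z - z0) ^+ 2).
  have [z zr|gk gk1 gk2] := tanC (S (n0 + k).+1 - S (n0 + k)%N) (1 / 2 ^+ k.+1) z0 (ltW z0s).
    rewrite !hornerE; apply: le_trans (SS _ _ (le_trans zr (an k))) _.
    rewrite div1r lef_pV2 ?posrE ?exprn_gt0// ler_eXn2l ?ltr1n// ltnS leq_addl//.
  exists gk; split; first by move: gk1; rewrite div1r.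
  by move=> z zs; have := gk2 z zs; rewrite !(hornerD, hornerN) div1r.
have [gs gsP] := choice step.
pose G k := g + \sum_(j < k) gs j.
have [k|l lP] := @geometric_limit G C.
  rewrite /G big_ord_recr/= [X in modulus X](_ : _ = gs k); last by ring.
  exact: (gsP k).1.
have GP k z : modulus z <= s ->
    modulus ((S (n0 + k)%N).[z] - (S (n0 + k)%N).[z0] - G k * (z - z0)) <=
    C * (B + 1 - 1 / 2 ^+ k) * modulus (z - z0) ^+ 2.
  move=> zs; elim: k => [|k IHk].
    rewrite addn0 /G big_ord0 addr0 expr0 divr1 addrK; exact: gP.
  rewrite addnS /G big_ord_recr/= addrA -/(G k).
  have -> : C * (B + 1 - 1 / 2 ^+ k.+1) * modulus (z - z0) ^+ 2 =
     C * (B + 1 - 1 / 2 ^+ k) * modulus (z - z0) ^+ 2 + C / 2 ^+ k.+1 * modulus (z - z0) ^+ 2.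
    by rewrite exprS invfM; field.
  apply: le_trans (lerD IHk ((gsP k).2 z zs)).
  by apply: le_trans (modulusD _ _); rewrite le_eqVlt; apply/orP; left; apply/eqP; congr modulus; ring.
apply: (@derivable_of_tangent f z0 l (C * (B + 1)) (s - modulus z0)); first by rewrite subr_gt0.
move=> z zd; have zs : modulus z <= s.
  have := modulus_sub_ge z z0; move: zd; lra.
apply: (@le_half_powers _ _ (4 + 2 * C * modulus (z - z0))) => k.
have kn : 2 ^+ k <= 2 ^+ (n0 + k) :> R by rewrite ler_eXn2l ?ltr1n// leq_addl.
have bnd w : modulus w <= s -> modulus ((S (n0 + k)%N).[w] - f w) <= 2 / 2 ^+ k.
  move=> ws; apply: le_trans (fS _ _ _) _.
    by apply: (le_trans ws); apply: le_trans (an k); case/andP: srho => _ /ltW.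
  by rewrite ler_pM2l// lef_pV2 ?posrE ?exprn_gt0.
have e1 := bnd z zs; have e2 := bnd z0 (ltW z0s); have e3 := GP k z zs; have e4 := lP k.
have -> : f z - f z0 - l * (z - z0) =
  ((S (n0 + k)%N).[z] - (S (n0 + k)%N).[z0] - G k * (z - z0)) + (f z - (S (n0 + k)%N).[z])
  + (((S (n0 + k)%N).[z0] - f z0) + (G k - l) * (z - z0)) by ring.
have m0 := modulus_ge0 (z - z0).
have e5 : modulus (G k - l) * modulus (z - z0) <= 2 * (C / 2 ^+ k) * modulus (z - z0).
  by rewrite ler_wpM2r.
rewrite modulusB in e1.
have i1 := modulusD (((S (n0 + k)%N).[z] - (S (n0 + k)%N).[z0] - G k * (z - z0)) + (f z - (S (n0 + k)%N).[z]))
  (((S (n0 + k)%N).[z0] - f z0) + (G k - l) * (z - z0)).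
have i2 := modulusD ((S (n0 + k)%N).[z] - (S (n0 + k)%N).[z0] - G k * (z - z0)) (f z - (S (n0 + k)%N).[z]).
have i3 := modulusD ((S (n0 + k)%N).[z0] - f z0) ((G k - l) * (z - z0)).
rewrite modulusM in i3.
have e6 : C * (B + 1 - 1 / 2 ^+ k) * modulus (z - z0) ^+ 2 <= C * (B + 1) * modulus (z - z0) ^+ 2.
  by rewrite ler_wpM2r ?sqr_ge0// ler_wpM2l// gerBl divr_ge0// exprn_ge0.
have -> : (4 + 2 * C * modulus (z - z0)) / 2 ^+ k = 2 / 2 ^+ k + 2 / 2 ^+ k + 2 * (C / 2 ^+ k) * modulus (z - z0).
  by field.
lra.
Qed.

End Limits.

(** * Uniform approximation by polynomials and pole pushing *)

(** The function [g] is a uniform limit of polynomials on [L]. *)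
Definition poly_approx {R : realType} (L : set R[i]) (g : R[i] -> R[i]) : Prop :=
  forall e : R, 0 < e ->
    exists p : {poly R[i]}, forall z, L z -> modulus (g z - p.[z]) <= e.

Section Runge.
Variables (R : realType) (L : set R[i]) (rho : R).
Hypothesis L_bounded : forall z, L z -> modulus z <= rho.
Implicit Types (g h v : R[i] -> R[i]) (z w zeta : R[i]).

Lemma poly_approx_eq g h : (forall z, L z -> g z = h z) ->
  poly_approx L g -> poly_approx L h.
Proof.
move=> gh gL e e0; have [p pP] := gL e e0.
by exists p => z Lz; rewrite -gh// pP.
Qed.

Lemma poly_approx_poly (p : {poly R[i]}) : poly_approx L (fun z => p.[z]).
Proof. by move=> e e0; exists p => z _; rewrite subrr modulus0 ltW. Qed.

Lemma poly_approx_cst c : poly_approx L (fun=> c).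
Proof.
by apply: poly_approx_eq (poly_approx_poly c%:P) => z _; rewrite hornerC.
Qed.

Lemma poly_approx_id : poly_approx L id.
Proof. by apply: poly_approx_eq (poly_approx_poly 'X) => z _; rewrite hornerX. Qed.

Lemma poly_approx_bounded g : poly_approx L g ->
  exists2 B, 0 <= B & forall z, L z -> modulus (g z) <= B.
Proof.
move=> gL; have [p pP] := gL 1 ltr01; have [B B0 pB] := poly_bounded p rho.
exists (1 + B) => [|z Lz]; first by rewrite addr_ge0.
by rewrite -[g z](subrK p.[z]) (le_trans (modulusD _ _))// lerD ?pP// pB// L_bounded.
Qed.

Lemma poly_approx_limit g :
  (forall e, 0 < e -> exists2 h, poly_approx L h &
    forall z, L z -> modulus (g z - h z) <= e) -> poly_approx L g.
Proof.
move=> gl e e0; have e20 : 0 < e / 2 by rewrite divr_gt0.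
have [h hL gh] := gl _ e20; have [p pP] := hL _ e20.
exists p => z Lz; apply: le_trans (modulus_triangle _ (h z) _) _.
by rewrite [leRHS]splitr lerD ?gh ?pP.
Qed.

Lemma poly_approxD g h : poly_approx L g -> poly_approx L h ->
  poly_approx L (fun z => g z + h z).
Proof.
move=> gL hL e e0; have e20 : 0 < e / 2 by rewrite divr_gt0.
have [p pP] := gL _ e20; have [q qP] := hL _ e20.
exists (p + q) => z Lz; rewrite hornerD opprD addrACA (le_trans (modulusD _ _))//.
by rewrite [leRHS]splitr lerD ?pP ?qP.
Qed.

Lemma poly_approxM g h : poly_approx L g -> poly_approx L h ->
  poly_approx L (fun z => g z * h z).
Proof.
move=> gL hL; have [B B0 gB] := poly_approx_bounded gL.
move=> e e0; have B1 : 0 < B + 1 by rewrite ltr_pwDr.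
have [q1 q1P] : exists q : {poly R[i]}, forall z, L z -> modulus (h z - q.[z]) <= e / 2 / (B + 1).
  by apply: hL; rewrite !divr_gt0.
have [D1 D10 qD1] := poly_bounded q1 rho.
have D11 : 0 < D1 + 1 by rewrite ltr_pwDr.
have [p1 p1P] : exists p : {poly R[i]}, forall z, L z -> modulus (g z - p.[z]) <= e / 2 / (D1 + 1).
  by apply: gL; rewrite !divr_gt0.
exists (p1 * q1) => z Lz; rewrite hornerM.
have -> : g z * h z - p1.[z] * q1.[z] =
  g z * (h z - q1.[z]) + q1.[z] * (g z - p1.[z]) by ring.
apply: le_trans (modulusD _ _) _; rewrite [leRHS]splitr !modulusM lerD//.
  apply: (@le_trans _ _ ((B + 1) * (e / 2 / (B + 1)))); last by rewrite mulrC divfK ?gt_eqF.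
  by rewrite ler_pM ?modulus_ge0 ?q1P// (le_trans (gB _ Lz))// lerDl.
apply: (@le_trans _ _ ((D1 + 1) * (e / 2 / (D1 + 1)))); last by rewrite mulrC divfK ?gt_eqF.
by rewrite ler_pM ?modulus_ge0 ?p1P// (le_trans (qD1 _ (L_bounded Lz)))// lerDl.
Qed.

Lemma poly_approxX g n : poly_approx L g -> poly_approx L (fun z => g z ^+ n).
Proof.
move=> gL; elim: n => [|n IHn].
  by apply: poly_approx_eq (poly_approx_cst 1) => z _; rewrite expr0.
by apply: poly_approx_eq (poly_approxM gL IHn) => z _; rewrite exprS.
Qed.

Lemma poly_approx_sum (I : Type) (s : seq I) (F : I -> R[i] -> R[i]) :
  (forall i, poly_approx L (F i)) -> poly_approx L (fun z => \sum_(i <- s) F i z).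
Proof.
move=> FL; elim: s => [|i s IHs].
  by apply: poly_approx_eq (poly_approx_cst 0) => z _; rewrite big_nil.
by apply: poly_approx_eq (poly_approxD (FL i) IHs) => z _; rewrite big_cons.
Qed.

Lemma poly_approx_prod (I : eqType) (s : seq I) (F : I -> R[i] -> R[i]) :
  (forall i, i \in s -> poly_approx L (F i)) ->
  poly_approx L (fun z => \prod_(i <- s) F i z).
Proof.
elim: s => [_|i s IHs FL].
  by apply: poly_approx_eq (poly_approx_cst 1) => z _; rewrite big_nil.
have Fi := FL i (mem_head _ _).
have Fs : poly_approx L (fun z => \prod_(j <- s) F j z).
  by apply: IHs => j js; apply: FL; rewrite in_cons js orbT.
by apply: poly_approx_eq (poly_approxM Fi Fs) => z _; rewrite big_cons.
Qed.

(** The uniform limits of polynomials on [L] are stable under the geometric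
    series, which is what moves poles around. *)
Lemma poly_approx_geometric v q : q < 1 -> poly_approx L v ->
  (forall z, L z -> modulus (v z) <= q) -> poly_approx L (fun z => (1 - v z)^-1).
Proof.
move=> q1 vL vq; apply: poly_approx_limit => e e0.
have [[z0 Lz0]|noL] := pselect (exists z, L z); last first.
  by exists (fun=> 0) => [|z Lz]; [exact: poly_approx_cst | case: noL; exists z].
have q0 : 0 <= q by apply: le_trans (vq _ Lz0); exact: modulus_ge0.
have [n nq] : exists n, q ^+ n <= e * (1 - q).
  have eq0 : 0 < e * (1 - q) by rewrite mulr_gt0 ?subr_gt0.
  have : (fun n => q ^+ n) @ \oo --> (0 : R) by apply: cvg_expr; rewrite ger0_norm.
  move/cvgrPdist_le => /(_ _ eq0) [n _ /(_ n (leqnn n))] /=.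
  by rewrite sub0r normrN ger0_norm ?exprn_ge0// => ?; exists n.
exists (fun z => \sum_(i < n) v z ^+ i) => [|z Lz].
  apply: poly_approx_eq (poly_approx_sum (index_enum 'I_n) (fun i => poly_approxX i vL)) => z _.
  by [].
have v1 : 1 - q <= modulus (1 - v z).
  by apply: le_trans (modulus_sub_ge _ _); rewrite modulus1 lerD2l lerN2 vq.
have v0 : 1 - v z != 0 by rewrite -modulus_gt0 (lt_le_trans _ v1)// subr_gt0.
have -> : (1 - v z)^-1 - \sum_(i < n) v z ^+ i = v z ^+ n / (1 - v z).
  apply: (mulIf v0); rewrite mulrBl mulVf// divfK//.
  have -> : v z ^+ n = 1 + (v z - 1) * \sum_(i < n) v z ^+ i by rewrite -subrX1; ring.
  by ring.
rewrite modulusM modulusX modulusV ler_pdivrMr ?(lt_le_trans _ v1)// ?subr_gt0//.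
apply: (@le_trans _ _ (q ^+ n)); first by rewrite lerXn2r ?nnegrE ?modulus_ge0 ?vq.
by apply: le_trans nq _; rewrite ler_wpM2l// ltW.
Qed.

(** For a pole outside a disc centered at 0 that contains [L], the geometric
    series in [z] converges uniformly on [L]. *)
Lemma poly_approx_far_pole zeta : rho < modulus zeta ->
  poly_approx L (fun z => (z - zeta)^-1).
Proof.
move=> rz; have [[y Ly]|noL] := pselect (exists z, L z); last first.
  by move=> e _; exists 0 => z Lz; case: noL; exists z.
have rho0 : 0 <= rho by apply: le_trans (L_bounded Ly); exact: modulus_ge0.
have m0 : 0 < modulus zeta by apply: le_lt_trans rz.
have z0 : zeta != 0 by rewrite -modulus_gt0.
have q1 : rho / modulus zeta < 1 by rewrite ltr_pdivrMr// mul1r.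
have vL : poly_approx L (fun z => z * zeta^-1).
  exact: poly_approxM poly_approx_id (poly_approx_cst _).
have vq z : L z -> modulus (z * zeta^-1) <= rho / modulus zeta.
  by move=> Lz; rewrite modulusM modulusV ler_wpM2r ?L_bounded// invr_ge0 ltW.
have gL := poly_approx_geometric q1 vL vq.
apply: poly_approx_eq (poly_approxM (poly_approx_cst (- zeta^-1)) gL) => z Lz.
by rewrite mulNr -invfM mulrBr mulr1 mulrC divfK// -invrN opprB.
Qed.

(** A pole at distance at least [d] from [L] may be moved by less than [d]. *)
Lemma push_pole zeta xi d : modulus (xi - zeta) < d ->
  (forall z, L z -> d <= modulus (z - zeta)) ->
  poly_approx L (fun z => (z - zeta)^-1) -> poly_approx L (fun z => (z - xi)^-1).
Proof.
move=> xd dL zL; have d0 : 0 < d by apply: le_lt_trans xd; exact: modulus_ge0.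
have q1 : modulus (xi - zeta) / d < 1 by rewrite ltr_pdivrMr// mul1r.
have vL := poly_approxM (poly_approx_cst (xi - zeta)) zL.
have vq z : L z -> modulus ((xi - zeta) * (z - zeta)^-1) <= modulus (xi - zeta) / d.
  move=> Lz; rewrite modulusM modulusV ler_wpM2l ?modulus_ge0// lef_pV2 ?posrE ?dL//.
  by rewrite (lt_le_trans d0)// dL.
apply: poly_approx_eq (poly_approxM zL (poly_approx_geometric q1 vL vq)) => z Lz.
have z0 : z - zeta != 0 by rewrite -modulus_gt0 (lt_le_trans d0)// dL.
by rewrite -invfM mulrBr mulr1 mulrC divfK// opprB subrKA.
Qed.

(** Poles may be moved along a Lipschitz path that stays away from [L]. *)
Lemma push_pole_path (gamma : R -> R[i]) (l d : R) : 0 < d ->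
  (forall s t : R, 0 <= s <= 1 -> 0 <= t <= 1 ->
    modulus (gamma s - gamma t) <= l * `|s - t|) ->
  (forall (t : R) z, 0 <= t <= 1 -> L z -> d <= modulus (z - gamma t)) ->
  poly_approx L (fun z => (z - gamma 0)^-1) ->
  poly_approx L (fun z => (z - gamma 1)^-1).
Proof.
move=> d0 lip dist g0.
have l0 : 0 <= l.
  have := lip 0 1; rewrite !lexx !ler01 => /(_ isT isT); rewrite sub0r normrN normr1 mulr1.
  by apply: le_trans; exact: modulus_ge0.
pose N := (Num.bound (l / d)).+1.
have N0 : 0 < N%:R :> R by rewrite ltr0n.
have lN : l / N%:R < d.
  rewrite ltr_pdivrMr// mulrC -ltr_pdivrMr//.
  apply: lt_le_trans (archi_boundP _) _; first by rewrite divr_ge0// ltW.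
  by rewrite ler_nat.
have inI k : (k <= N)%N -> 0 <= (k%:R / N%:R : R) <= 1.
  by move=> kN; rewrite divr_ge0//= ler_pdivrMr// mul1r ler_nat.
have main k : (k <= N)%N -> poly_approx L (fun z => (z - gamma (k%:R / N%:R))^-1).
  elim: k => [|k IHk] kN; first by rewrite mul0r.
  apply: (@push_pole (gamma (k%:R / N%:R)) _ d _ _ (IHk (ltnW kN))); last first.
    by move=> z; apply: dist; exact/inI/ltnW.
  have step := lip _ _ (inI _ kN) (inI _ (ltnW kN)).
  apply: (le_lt_trans step).
  by rewrite -mulrBl -natrB// subSnn mul1r ger0_norm ?invr_ge0// ltW.
by have := main N (leqnn N); rewrite divff ?gt_eqF.
Qed.

End Runge.

(** * Cayley parametrization of the circle and holomorphic cutoffs *)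

(** The Cayley transform maps the real line onto the unit circle deprived of 1.
    Arcs of the circle that avoid 1 are images of segments. *)
Definition cayley {R : realType} (t : R) : R[i] := (t%:C + 'i%C) / (t%:C - 'i%C).

Section Cayley.
Variable R : realType.
Implicit Types (s t x : R) (z w : R[i]).

Lemma modulus_shift_ge1 t : 1 <= modulus (t%:C - 'i%C).
Proof. by have := Im_le_modulus (t%:C - 'i%C); rewrite /= add0r normrN normr1. Qed.

Lemma cayley_den_neq0 t : t%:C - 'i%C != 0.
Proof. by rewrite -modulus_gt0 (lt_le_trans ltr01)// modulus_shift_ge1. Qed.

Lemma modulus_shift_le t : modulus (t%:C - 'i%C) <= `|t| + 1.
Proof.
apply: le_trans (modulus_le_ReIm _) _.
by rewrite /= add0r oppr0 addr0 normrN normr1.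
Qed.

Lemma modulus_cayley t : modulus (cayley t) = 1.
Proof.
rewrite /cayley modulusM modulusV (_ : modulus (t%:C + 'i%C) = modulus (t%:C - 'i%C)).
  by rewrite divff// gt_eqF// (lt_le_trans ltr01)// modulus_shift_ge1.
by rewrite /modulus /= !add0r !sqrrN oppr0.
Qed.

Lemma modulus_i : modulus ('i%C : R[i]) = 1.
Proof. by rewrite /modulus /= expr0n/= add0r expr1n sqrtr1. Qed.

Lemma cayleyE t : cayley t = 1 + 2 * 'i%C / (t%:C - 'i%C).
Proof. by rewrite /cayley; field; exact: cayley_den_neq0. Qed.

Lemma cayley_lipschitz s t : modulus (cayley s - cayley t) <= 2 * `|s - t|.
Proof.
have -> : cayley s - cayley t =
    2 * 'i%C * (t - s)%:C / (s%:C - 'i%C) / (t%:C - 'i%C).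
  by rewrite !cayleyE rmorphB /=; field; rewrite !cayley_den_neq0.
rewrite !modulusM !modulusV modulus_nat modulus_i mulr1 modulus_real distrC.
rewrite !ler_pdivrMr ?(lt_le_trans ltr01) ?modulus_shift_ge1//.
rewrite -mulrA ler_peMr ?mulr_ge0// -[leLHS]mulr1.
by rewrite ler_pM// modulus_shift_ge1.
Qed.

Lemma cayley_dist1 t : 2 / (`|t| + 1) <= modulus (cayley t - 1).
Proof.
rewrite cayleyE addrAC subrr add0r !modulusM modulusV modulus_nat modulus_i mulr1.
have p1 : 0 < `|t| + 1 by rewrite ltr_pwDr.
have p2 : 0 < modulus (t%:C - 'i%C) by rewrite (lt_le_trans ltr01)// modulus_shift_ge1.
by rewrite ler_pM2l// lef_pV2 ?posrE// modulus_shift_le.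
Qed.

Lemma cayley_near1 t : 0 < t -> modulus (cayley t - 1) <= 2 / t.
Proof.
move=> t0; rewrite cayleyE addrAC subrr add0r !modulusM modulusV modulus_nat modulus_i mulr1.
have p2 : 0 < modulus (t%:C - 'i%C) by rewrite (lt_le_trans ltr01)// modulus_shift_ge1.
rewrite ler_pM2l// lef_pV2 ?posrE//.
by have := Re_le_modulus (t%:C - 'i%C); rewrite /= oppr0 addr0; apply: le_trans; exact: ler_norm.
Qed.

Lemma cayley_surj z : modulus z = 1 -> z != 1 -> exists t, z = cayley t.
Proof.
move=> z1 zn1; have := modulus_sq z; rewrite z1 expr1n.
case: z z1 zn1 => a b _ zn1 /= ab.
have a1 : 1 - a != 0.
  apply: contraNneq zn1 => /eqP; rewrite subr_eq0 => /eqP a1.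
  move: ab; rewrite -a1 expr1n => /eqP; rewrite addrC -subr_eq subrr eq_sym sqrf_eq0 => /eqP ->.
  by [].
pose t := b / (1 - a); have tb : t * (1 - a) = b by rewrite divfK.
have bt : b * t - a - 1 = 0.
  apply: (mulIf a1); rewrite mul0r.
  have -> : (b * t - a - 1) * (1 - a) = b * (t * (1 - a)) - (1 - a ^+ 2) by ring.
  by rewrite tb ab; ring.
exists t; rewrite /cayley.
apply: (mulIf (cayley_den_neq0 t)); rewrite divfK ?cayley_den_neq0//.
by apply/eqP; rewrite eq_complex /=; apply/andP; split; apply/eqP; lra.
Qed.

(** A lower bound on the distance between points of two rays from the origin. *)
Lemma ray_distance (s x : R) (w z : R[i]) : 0 <= s -> 0 <= x -> modulus w = 1 -> modulus z = 1 ->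
  s / 2 * modulus (w - z) <= modulus (s%:C * w - x%:C * z).
Proof.
move=> s0 x0 w1 z1.
have i1 : `|s - x| <= modulus (s%:C * w - x%:C * z).
  have := modulus_sub_ge (s%:C * w) (x%:C * z); have := modulus_sub_ge (x%:C * z) (s%:C * w).
  rewrite [X in _ <= X -> _]modulusB !modulusM !modulus_real w1 z1 !mulr1.
  rewrite (ger0_norm s0) (ger0_norm x0) ler_norml => ? ?; apply/andP; split; lra.
have i2 : s * modulus (w - z) <= modulus (s%:C * w - x%:C * z) + `|x - s|.
  have -> : s * modulus (w - z) = modulus (s%:C * (w - z)).
    by rewrite modulusM modulus_real ger0_norm.
  have -> : s%:C * (w - z) = s%:C * w - x%:C * z + (x - s)%:C * z by rewrite rmorphB/=; ring.
  by apply: le_trans (modulusD _ _) _; rewrite modulusM modulus_real z1 mulr1.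
by move: i1 i2; rewrite (distrC x) mulrAC; lra.
Qed.

End Cayley.

(** The circle with an open gap of radius [delta] around [w]. *)
Definition gapped_circle {R : realType} (w : R[i]) (delta : R) : set R[i] :=
  [set z | modulus z = 1 /\ delta <= modulus (z - w)].

Section CutoffPolynomial.
Variable R : realType.
Implicit Types (s t x : R) (z w : R[i]).

Lemma gapped_circle_bounded w delta z : gapped_circle w delta z -> modulus z <= 1.
Proof. by case=> ->. Qed.

(** The union of the disc of radius [a], of the segment from 0 to 1, and of the
    circle of radius [r] with a gap in the direction of [w]. *)
Definition lollipop (w : R[i]) (delta a r : R) : set R[i] :=
  [set z | [\/ modulus z <= a, exists2 x, 0 <= x <= 1 & z = x%:C |
    exists2 y, gapped_circle w delta y & z = r%:C * y]].

Lemma lollipop_bounded w delta a r z : a <= 1 -> 0 <= r <= 1 ->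
  lollipop w delta a r z -> modulus z <= 1.
Proof.
move=> a1 /andP[r0 r1] [za|[x /andP[x0 x1] ->]|[y [y1 _] ->]].
- exact: le_trans a1.
- by rewrite modulus_real ger0_norm.
- by rewrite modulusM y1 mulr1 modulus_real ger0_norm.
Qed.

(** The poles come in from infinity along the ray through the gap, and then turn
    along the circle of radius [b] without crossing the positive axis. *)
Lemma lollipop_pole (q delta a b r t : R) : 0 < delta -> 0 <= a -> a < b -> b < r -> r <= 1 ->
  poly_approx (lollipop (cayley q) delta a r) (fun z => (z - b%:C * cayley t)^-1).
Proof.
move=> delta0 a0 ab br r1; set w := cayley q; set L := lollipop w delta a r.
have b0 : 0 < b by apply: le_lt_trans ab.
have Lb z : L z -> modulus z <= 1.
  by apply: lollipop_bounded; rewrite ?r1 ?andbT; lra.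
have far : poly_approx L (fun z => (z - 2%:C * w)^-1).
  apply: (poly_approx_far_pole Lb).
  by rewrite modulusM modulus_cayley mulr1 modulus_real ger0_norm// ltr1n.
have near : poly_approx L (fun z => (z - b%:C * w)^-1).
  pose gamma x := (2 + x * (b - 2))%:C * w.
  pose d := Num.min (b - a) (Num.min (b / (`|q| + 1)) (b / 2 * delta)).
  have d0 : 0 < d.
    by rewrite !lt_min subr_gt0 ab divr_gt0 ?ltr_pwDr//= mulr_gt0// divr_gt0.
  have := @push_pole_path _ _ _ Lb gamma 2 d d0.
  have -> : gamma 0 = 2%:C * w by rewrite /gamma mul0r addr0.
  have -> : gamma 1 = b%:C * w by rewrite /gamma mul1r addrC subrK.
  apply => //.
    move=> s x _ _; rewrite -mulrBl -rmorphB modulusM modulus_cayley mulr1 modulus_real.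
    have -> : 2 + s * (b - 2) - (2 + x * (b - 2)) = (s - x) * (b - 2) by ring.
    by rewrite normrM mulrC ler_wpM2r// ler_norml; apply/andP; split; lra.
  move=> x z /andP[x0 x1] Lz; rewrite modulusB.
  have sb : b <= 2 + x * (b - 2) by nra.
  have s0 : 0 <= 2 + x * (b - 2) by lra.
  rewrite /gamma; set s := (2 + x * (b - 2)) in sb s0 *.
  rewrite !ge_min; case: Lz => [za|[y /andP[y0 y1] ->]|[y [y1 yw] ->]].
  - apply/orP; left; apply: le_trans (modulus_sub_ge _ _).
    by rewrite modulusM modulus_cayley mulr1 modulus_real ger0_norm//; lra.
  - apply/orP; right; apply/orP; left.
    have := @ray_distance _ s y w 1 s0 y0 (modulus_cayley _) (modulus1 _).
    rewrite mulr1; apply: le_trans.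
    apply: (@le_trans _ _ (s / 2 * (2 / (`|q| + 1)))); last first.
      by rewrite ler_wpM2l ?divr_ge0// cayley_dist1.
    by rewrite mulrA divfK ?pnatr_eq0// ler_wpM2r// invr_ge0 addr_ge0.
  - apply/orP; right; apply/orP; right.
    have := @ray_distance _ s r w y s0 (ltW (lt_trans b0 br)) (modulus_cayley _) y1.
    by apply: le_trans; rewrite modulusB; apply: ler_pM => //; lra.
pose gamma x := b%:C * cayley (q + x * (t - q)).
pose T := `|q| + `|t|; have T0 : 0 <= T by rewrite addr_ge0.
pose d := Num.min (b - a) (Num.min (b / (T + 1)) (r - b)).
have d0 : 0 < d.
  by rewrite !lt_min !subr_gt0 ab br divr_gt0 ?ltr_pwDr//=.
have := @push_pole_path _ _ _ Lb gamma (b * (2 * `|t - q|)) d d0.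
have -> : gamma 0 = b%:C * w by rewrite /gamma mul0r addr0.
have -> : gamma 1 = b%:C * cayley t by rewrite /gamma mul1r addrC subrK.
apply => //.
  move=> s x _ _; rewrite -mulrBr modulusM modulus_real gtr0_norm// -!mulrA ler_pM2l//.
  apply: le_trans (cayley_lipschitz _ _) _.
  by rewrite opprD addrACA subrr add0r -mulrBl normrM [`|s - x| * _]mulrC mulrA.
move=> x z /andP[x0 x1] Lz; rewrite /gamma.
have mg : modulus (b%:C * cayley (q + x * (t - q))) = b.
  by rewrite modulusM modulus_cayley mulr1 modulus_real gtr0_norm.
rewrite !ge_min; case: Lz => [za|[y /andP[y0 y1] ->]|[y [y1 yw] ->]].
- by rewrite modulusB; apply/orP; left; apply: le_trans (modulus_sub_ge _ _); rewrite mg; lra.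
- apply/orP; right; apply/orP; left; rewrite modulusB.
  have := @ray_distance _ b y (cayley (q + x * (t - q))) 1 (ltW b0) y0 (modulus_cayley _) (modulus1 _).
  rewrite mulr1; apply: le_trans.
  apply: (@le_trans _ _ (b / 2 * (2 / (T + 1)))).
    by rewrite mulrA divfK ?pnatr_eq0.
  rewrite ler_pM2l ?divr_gt0//; apply: le_trans (cayley_dist1 _).
  rewrite ler_pM2l// lef_pV2 ?posrE ?ltr_pwDr// lerD2r.
  have -> : q + x * (t - q) = (1 - x) * q + x * t by ring.
  apply: le_trans (ler_normD _ _) _; rewrite !normrM.
  have x1' : 0 <= 1 - x by rewrite subr_ge0.
  by rewrite (ger0_norm x0) (ger0_norm x1') lerD// ler_piMl// gerBl.
- apply/orP; right; apply/orP; right; apply: le_trans (modulus_sub_ge _ _).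
  by rewrite mg modulusM y1 mulr1 modulus_real ger0_norm//; lra.
Qed.

Lemma power_ratio_small (x y e : R) : 0 <= x < y -> 0 < e ->
  exists n0, forall n, (n0 <= n)%N -> x ^+ n <= e * y ^+ n.
Proof.
move=> /andP[x0 xy] e0; have y0 : 0 < y by apply: le_lt_trans xy.
have : (fun n => (x / y) ^+ n) @ \oo --> (0 : R).
  by apply: cvg_expr; rewrite ger0_norm ?divr_ge0 ?(ltW y0)// ltr_pdivrMr ?mul1r.
move/cvgrPdist_le => /(_ _ e0) [n0 _ H]; exists n0 => n n0n.
have := H n n0n; rewrite /= sub0r normrN ger0_norm ?exprn_ge0 ?divr_ge0 ?(ltW y0)//.
by rewrite exprMn exprVn ler_pdivrMr ?exprn_gt0.
Qed.

(** A polynomial which is small on the disc of radius [a], close to 1 on the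
    gapped circle of radius [r], and close to the unit interval on the segment
    from 0 to 1. It approximates [1 - Q] for a rational function [Q] without
    poles on the positive axis. *)
Lemma cutoff (q delta a r e : R) : 0 < delta -> 0 <= a < r -> r <= 1 -> 0 < e ->
  exists u : {poly R[i]}, [/\
    forall z, modulus z <= a -> modulus u.[z] <= e,
    forall z, gapped_circle (cayley q) delta z -> modulus (u.[r%:C * z] - 1) <= e &
    forall x, 0 <= x <= 1 -> exists2 t, 0 <= t <= 1 & modulus (u.[x%:C] - t%:C) <= e].
Proof.
move=> delta0 /andP[a0 ar] r1 e0; pose b := (a + r) / 2.
have [ab br] : a < b /\ b < r by rewrite /b; lra.
have b0 : 0 < b by apply: le_lt_trans ab.
pose e' := Num.min (1 / 2) (e / 4).
have e'0 : 0 < e' by rewrite lt_min !divr_gt0.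
have [e'1 e'2] : e' <= 1 / 2 /\ e' <= e / 4 by rewrite !ge_min !lexx orbT.
have [n1 n1P] := @power_ratio_small a b e' ltac:(by rewrite a0) e'0.
have [n2 n2P] := @power_ratio_small b r e' ltac:(by rewrite ltW) e'0.
pose N := (maxn n1 n2).+1.
have N0 : (0 < N)%N by [].
have aN : a ^+ N <= e' * b ^+ N by apply: n1P; rewrite leqW// leq_maxl.
have bN : b ^+ N <= e' * r ^+ N by apply: n2P; rewrite leqW// leq_maxr.
have bN0 : 0 < b ^+ N by rewrite exprn_gt0.
have rN0 : 0 < r ^+ N by rewrite exprn_gt0// (lt_trans b0).
pose L := lollipop (cayley q) delta a r.
have Lb z : L z -> modulus z <= 1.
  by apply: lollipop_bounded; rewrite ?r1 ?andbT; lra.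
pose Q z := (b ^+ N)%:C / (z ^+ N + (b ^+ N)%:C).
have QL : poly_approx L Q.
  have [rs Drs] := closed_field_poly_normal ('X^N - (- (b ^+ N)%:C)%:P : {poly R[i]}).
  rewrite (monicP _) ?monicXnsubC// scale1r in Drs.
  have QE z : L z -> (b ^+ N)%:C * \prod_(zeta <- rs) (z - zeta)^-1 = Q z.
    move=> _; rewrite /Q prodfV; congr (_ * _^-1).
    have := congr1 (fun p : {poly R[i]} => p.[z]) Drs.
    rewrite horner_prod /= hornerD hornerN hornerXn hornerC opprK => ->.
    by apply: eq_bigr => i _; rewrite !hornerE.
  apply: poly_approx_eq QE _; apply: (poly_approxM Lb (poly_approx_cst _ _)).
  apply: (poly_approx_prod Lb) => zeta zrs.
  have zN : zeta ^+ N = - (b ^+ N)%:C.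
    move: zrs; rewrite -root_prod_XsubC -Drs /root hornerD hornerN hornerXn hornerC opprK.
    by rewrite addr_eq0 => /eqP.
  have mz : modulus zeta = b.
    apply/eqP; rewrite -(@eqrXn2 _ N)// ?modulus_ge0 ?ltW// -modulusX zN modulusN.
    by rewrite modulus_real gtr0_norm.
  have bC : b%:C != 0 :> R[i] by rewrite -modulus_eq0 modulus_real gtr0_norm// gt_eqF.
  have [||t tE] := @cayley_surj _ (zeta / b%:C).
  - by rewrite modulusM modulusV mz modulus_real gtr0_norm// divff// gt_eqF.
  - apply/eqP => /divr1_eq zb; move: zN; rewrite zb -rmorphXn => /eqP.
    by rewrite -addr_eq0 -rmorphD (inj_eq (@complexI R) _ 0) gt_eqF ?addr_gt0.
  have -> : zeta = b%:C * cayley t by rewrite -tE mulrC divfK.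
  exact: lollipop_pole.
have [p pP] := QL (e / 2) ltac:(by rewrite divr_gt0).
exists (1 - p); split => [z za|z zG|x /andP[x0 x1]].
- have Lz : L z by exact: Or31.
  have := pP z Lz; rewrite !hornerE => pz.
  have zN : modulus (z ^+ N) <= e' * b ^+ N.
    by rewrite modulusX (le_trans _ aN)// lerXn2r ?nnegrE ?modulus_ge0.
  have den : b ^+ N / 2 <= modulus (z ^+ N + (b ^+ N)%:C).
    rewrite addrC; apply: le_trans (modulus_add_ge _ _).
    rewrite modulus_real gtr0_norm//; nra.
  have den0 : z ^+ N + (b ^+ N)%:C != 0.
    by rewrite -modulus_gt0 (lt_le_trans _ den)// divr_gt0.
  have Q1 : modulus (1 - Q z) <= e / 2.
    have -> : 1 - Q z = z ^+ N / (z ^+ N + (b ^+ N)%:C) by rewrite /Q; field.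
    rewrite modulusM modulusV ler_pdivrMr ?modulus_gt0//; nra.
  have -> : 1 - p.[z] = (1 - Q z) + (Q z - p.[z]) by ring.
  apply: le_trans (modulusD _ _) _; lra.
- have Lz : L (r%:C * z) by apply: Or33; exists z.
  have := pP _ Lz; rewrite !hornerE => pz; case: zG => z1 _.
  set y := r%:C * z in Lz pz *.
  have yN : modulus (y ^+ N) = r ^+ N.
    by rewrite modulusX modulusM z1 mulr1 modulus_real gtr0_norm ?(lt_trans b0).
  have den : r ^+ N / 2 <= modulus (y ^+ N + (b ^+ N)%:C).
    apply: le_trans (modulus_add_ge _ _).
    rewrite modulus_real gtr0_norm// yN; nra.
  have Q1 : modulus (Q y) <= e / 2.
    rewrite /Q modulusM modulusV modulus_real gtr0_norm//.
    rewrite ler_pdivrMr ?(lt_le_trans _ den) ?divr_gt0//; nra.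
  have -> : 1 - p.[y] - 1 = (Q y - p.[y]) - Q y by ring.
  apply: le_trans (modulusD _ _) _; rewrite modulusN; lra.
- have Lz : L x%:C by apply: Or32; exists x => //; rewrite x0.
  have := pP _ Lz; rewrite !hornerE => pz.
  pose t := b ^+ N / (x ^+ N + b ^+ N).
  have xN0 : 0 <= x ^+ N by rewrite exprn_ge0.
  have den0 : 0 < x ^+ N + b ^+ N by rewrite ltr_wpDl.
  exists (1 - t).
    rewrite subr_ge0 gerBl /t ler_pdivrMr// mul1r lerDr xN0 divr_ge0// ltW//.
  have -> : 1 - p.[x%:C] - (1 - t)%:C = Q x%:C - p.[x%:C].
    by rewrite /Q /t rmorphB fmorph_div rmorphD !rmorphXn /=; ring.
  lra.
Qed.

End CutoffPolynomial.

(** * Density of the polynomials on a gapped circle *)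

Section Density.
Variable R : realType.
Implicit Types (x t : R) (z w y zeta : R[i]).

Lemma poly_approx_inv w delta : 0 < delta -> modulus w = 1 ->
  poly_approx (gapped_circle w delta) (fun z => z^-1).
Proof.
move=> delta0 w1; have Lb := @gapped_circle_bounded R w delta.
pose gamma x := (2 - 2 * x)%:C * w.
have far : poly_approx (gapped_circle w delta) (fun z => (z - 2%:C * w)^-1).
  apply: (poly_approx_far_pole Lb).
  by rewrite modulusM w1 mulr1 modulus_real ger0_norm// ltr1n.
have := @push_pole_path _ _ _ Lb gamma 2 (delta / 2) (divr_gt0 delta0 (ltr0n _ 2)).
have -> : gamma 0 = 2%:C * w by rewrite /gamma mulr0 subr0.
have -> : gamma 1 = 0 by rewrite /gamma mulr1 subrr mul0r.
move=> push; suff : poly_approx (gapped_circle w delta) (fun z => (z - 0)^-1).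
  by apply: poly_approx_eq => z _; rewrite subr0.
apply: push => //.
  move=> s t _ _; rewrite -mulrBl -rmorphB modulusM w1 mulr1 modulus_real.
  have -> : 2 - 2 * s - (2 - 2 * t) = 2 * (t - s) by ring.
  by rewrite normrM distrC ger0_norm.
move=> t z /andP[t0 t1] [z1 zw].
have t2 : 0 <= 2 - 2 * t by lra.
have := @ray_distance _ 1 (2 - 2 * t) z w ler01 t2 z1 w1.
rewrite rmorph1 [1 * z]mul1r; apply: le_trans; lra.
Qed.

Lemma coef_1DXn n k : (('X + 1) ^+ n : {poly R[i]})`_k = 'C(n, k)%:R.
Proof.
rewrite exprD1n coef_sum.
have [kn|nk] := ltnP k n.+1.
  rewrite (bigD1 (Ordinal kn))//= coefMn coefXn eqxx big1 ?addr0// => i ik.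
  rewrite coefMn coefXn; case: eqP => [ki|_]; last by rewrite mul0rn.
  by move/eqP: ik; case; apply/val_inj.
rewrite bin_small// big1// => i _; rewrite coefMn coefXn gtn_eqF ?mul0rn//.
by apply: leq_trans nk; exact: ltn_ord.
Qed.

Lemma modulus_1Dy y : modulus y = 1 -> (1 + y) * (1 + y^-1) = (modulus (1 + y) ^+ 2)%:C.
Proof.
move=> y1; have y0 : y != 0 by rewrite -modulus_gt0 y1.
rewrite modulus_sq; have := modulus_sq y; rewrite y1 expr1n.
case: y {y1} y0 => a b y0 /= ab.
have -> : (a +i* b)^-1 = a -i* b.
  apply: (mulfI y0); rewrite divff//; apply/eqP.
  by rewrite eq_complex /=; apply/andP; split; apply/eqP; [lra|ring].
by apply/eqP; rewrite eq_complex /=; apply/andP; split; apply/eqP; ring.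
Qed.

Lemma modulus_parallelogram y : modulus y = 1 ->
  modulus (1 - y) ^+ 2 = 4 - modulus (1 + y) ^+ 2.
Proof.
move=> y1; have := modulus_sq y; rewrite y1 expr1n !modulus_sq.
by case: y {y1} => a b /= ab; rewrite !add0r; lra.
Qed.

(** The sum over the [m]-th roots of unity of an even power of [|1 + y| / 2] is a
    central coefficient: for [|y| = 1], the square of [|1 + y|] is
    [y^-1 * (1 + y)^2]. *)
Lemma kernel_mean m n (e z : R[i]) : m.-primitive_root e -> (2 * n < m)%N -> modulus z = 1 ->
  \sum_(j < m) (modulus (1 + z^-1 * e ^+ j) / 2) ^+ (2 * n) = m%:R * 'C(2 * n, n)%:R / 4 ^+ n.
Proof.
move=> prim nm z1; apply: complexI.
have m0 : (0 < m)%N by apply: leq_ltn_trans nm.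
have e1 : modulus e = 1 by exact: modulus_unity_root m0 (prim_expr_order prim).
have z0 : z != 0 by rewrite -modulus_gt0 z1.
have e0 : e != 0 by rewrite -modulus_gt0 e1.
pose p : {poly R[i]} := ('X + 1) ^+ (2 * n).
have sp : (size p <= m)%N.
  apply: leq_trans (size_exp_leq _ _) _; rewrite size_XaddC/= mul1n; exact: nm.
have := @coef_unity_root_sum _ m e p z^-1 n prim sp _ _.
rewrite coef_1DXn invr_eq0 => H.
have {}H : \sum_(j < m) p.[z^-1 * e ^+ j] / (z^-1 * e ^+ j) ^+ n = m%:R * 'C(2 * n, n)%:R.
  by apply: H => //; apply: leq_ltn_trans nm; rewrite leq_pmull.
rewrite !rmorphM !rmorph_nat fmorphV -H.
rewrite rmorph_sum big_distrl/=; apply: eq_bigr => j _.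
set y := z^-1 * e ^+ j.
have y1 : modulus y = 1 by rewrite modulusM modulusV z1 invr1 mul1r modulusX e1 expr1n.
have y0 : y != 0 by rewrite -modulus_gt0 y1.
rewrite exprM expr_div_n (_ : 2 ^+ 2 = 4); last by ring.
rewrite expr_div_n rmorphM fmorphV rmorphXn /= -modulus_1Dy//.
congr (_ / _); rewrite horner_exp !hornerE exprM -exprVn -exprMn; congr (_ ^+ _).
by field.
Qed.

(** Discrete convolution with the de la Vallee-Poussin kernel. The values [H] on
    the circle stand for an extension of [h] to the circle. The weights are
    nonnegative with sum [c], and their second moment around [z] is
    [2 * c / n.+1], so Chebyshev's inequality applies. *)
Lemma kernel_approximation (K : set R[i]) (h : R[i] -> R[i]) w delta :
  0 < delta -> modulus w = 1 -> K `<=` gapped_circle w delta ->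
  (forall e, 0 < e -> exists (H : R[i] -> R[i]) (D : R), forall zeta z, modulus zeta = 1 -> K z ->
     modulus (H zeta - h z) <= e + D * modulus (zeta - z) ^+ 2) ->
  poly_approx K h.
Proof.
move=> delta0 w1 KL hH; apply: poly_approx_limit => e0 e00.
have e20 : 0 < e0 / 2 by rewrite divr_gt0.
have [H [D' HD']] := hH _ e20.
pose D := `|D'|; have D0 : 0 <= D by exact: normr_ge0.
have HD zeta z : modulus zeta = 1 -> K z ->
    modulus (H zeta - h z) <= e0 / 2 + D * modulus (zeta - z) ^+ 2.
  move=> zeta1 Kz; apply: le_trans (HD' _ _ zeta1 Kz) _.
  by rewrite lerD2l ler_wpM2r ?sqr_ge0// ler_norm.
pose n := Num.bound (2 * D / (e0 / 2)).
have nD : 2 * D / n.+1%:R <= e0 / 2.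
  rewrite ler_pdivrMr ?ltr0n// [_ * n.+1%:R]mulrC -ler_pdivrMr//.
  have x0 : 0 <= 2 * D / (e0 / 2) by rewrite divr_ge0 ?mulr_ge0// ltW.
  by rewrite (le_trans (ltW (archi_boundP x0)))// ler_nat.
(* [m] exceeds the degrees [2 * n] and [2 * n.+1] of the two kernels below *)
pose m := (2 * n).+3; have [e prim] := prim_root_exists R (ltn0Sn _ : 0 < m)%N.
have e1 : modulus e = 1 by exact: modulus_unity_root (prim_expr_order prim).
pose c := m%:R * 'C(2 * n, n)%:R / 4 ^+ n : R.
have c0 : 0 < c by rewrite /c divr_gt0 ?exprn_gt0// mulr_gt0 ?ltr0n// bin_gt0 leq_pmull.
pose W z j := (modulus (1 + z^-1 * e ^+ j) / 2) ^+ (2 * n).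
have W0 z j : 0 <= W z j by rewrite exprn_ge0 ?divr_ge0 ?modulus_ge0.
have Wc z : modulus z = 1 -> \sum_(j < m) W z j = c.
  by move=> z1; apply: kernel_mean => //; rewrite /m ltnS leqW// leqW.
have Wm z : modulus z = 1 -> \sum_(j < m) W z j * modulus (e ^+ j - z) ^+ 2 = 2 * c / n.+1%:R.
  move=> z1; pose c' := m%:R * 'C(2 * n.+1, n.+1)%:R / 4 ^+ n.+1 : R.
  have z0 : z != 0 by rewrite -modulus_gt0 z1.
  have Wc' : \sum_(j < m) W z j * (modulus (1 + z^-1 * e ^+ j) / 2) ^+ 2 = c'.
    rewrite /c' -(@kernel_mean m n.+1 e z)//; last by rewrite /m mulnS.
    by apply: eq_bigr => j _; rewrite /W -exprD mulnS addnC.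
  have cc' : c' * n.+1%:R = c * (2 * n + 1)%:R / 2.
    have binE : ('C(2 * n.+1, n.+1) * n.+1 = 2 * ((2 * n + 1) * 'C(2 * n, n)))%N.
      have := mul_bin_diag (2 * n).+2 n; have := mul_bin_down (2 * n).+1 n.
      have -> : (2 * n.+1 = (2 * n).+2)%N by lia.
      have -> : ((2 * n).+1 - n = n.+1)%N by lia.
      rewrite /=.
      nia.
    rewrite /c' /c exprS; move: binE => /(congr1 (fun k => k%:R : R)).
    rewrite !natrM => binE.
    have -> : m%:R * 'C(2 * n.+1, n.+1)%:R / (4 * 4 ^+ n) * n.+1%:R =
      m%:R * ('C(2 * n.+1, n.+1)%:R * n.+1%:R) / (4 * 4 ^+ n) :> R by ring.
    rewrite binE; field.
    by rewrite expf_neq0.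
  have -> : 2 * c / n.+1%:R = 4 * (c - c').
    have n0 : n.+1%:R != 0 :> R by rewrite pnatr_eq0.
    apply: (mulIf n0); rewrite divfK// -mulrA mulrBl cc'.
    by rewrite natrD natrM -[n.+1]addn1 natrD; field.
  rewrite -Wc' -(Wc z z1) -sumrB big_distrr/=; apply: eq_bigr => j _.
  have y1 : modulus (z^-1 * e ^+ j) = 1 by rewrite modulusM modulusV z1 invr1 mul1r modulusX e1 expr1n.
  have -> : modulus (e ^+ j - z) = modulus (1 - z^-1 * e ^+ j).
    rewrite modulusB -[in RHS](mulVf z0) -mulrBr modulusM modulusV z1 invr1 mul1r//.
  by rewrite modulus_parallelogram//; field.
clearbody c.
exists (fun z => \sum_(j < m) (H (e ^+ j) / (c * 4 ^+ n)%:C) * ((1 + z^-1 * e ^+ j) * (1 + z * e ^- j)) ^+ n).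
  have Kb z : K z -> modulus z <= 1 by move/KL/gapped_circle_bounded.
  have inv : poly_approx K (fun z => z^-1).
    move=> d d0; have [p pP] := poly_approx_inv delta0 w1 d0.
    by exists p => z Kz; apply/pP/KL.
  apply: poly_approx_sum => // j; apply: (poly_approxM Kb); first exact: poly_approx_cst.
  apply: (poly_approxX Kb); apply: (poly_approxM Kb); apply: poly_approxD => //;
    try exact: poly_approx_cst.
    by apply: (poly_approxM Kb) => //; exact: poly_approx_cst.
  by apply: (poly_approxM Kb) => //; [exact: poly_approx_id | exact: poly_approx_cst].
move=> z Kz; have [z1 _] := KL _ Kz.
have z0 : z != 0 by rewrite -modulus_gt0 z1.
have eN0 : e != 0 by rewrite -modulus_gt0 e1.
have WE (j : 'I_m) : ((1 + z^-1 * e ^+ j) * (1 + z * e ^- j)) ^+ n = (4 ^+ n * W z j)%:C.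
  have y1 : modulus (z^-1 * e ^+ j) = 1 by rewrite modulusM modulusV z1 invr1 mul1r modulusX e1 expr1n.
  have -> : z * e ^- j = (z^-1 * e ^+ j)^-1 by rewrite invfM invrK.
  rewrite modulus_1Dy// /W exprM expr_div_n (_ : 2 ^+ 2 = 4); last by ring.
  rewrite -exprMn -[LHS]rmorphXn; congr (_%:C); congr (_ ^+ _).
  by rewrite mulrCA divff ?mulr1// pnatr_eq0.
have -> : h z = \sum_(j < m) (h z * (W z j / c)%:C).
  by rewrite -big_distrr/= -rmorph_sum -big_distrl/= Wc// divff ?gt_eqF// mulr1.
rewrite -sumrB; apply: le_trans (modulus_sum _ _ _) _.
apply: (@le_trans _ _ (\sum_(j < m) (W z j / c * (e0 / 2 + D * modulus (e ^+ j - z) ^+ 2)))).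
  apply: ler_sum => j _; rewrite WE.
  have -> : h z * (W z j / c)%:C - H (e ^+ j) / (c * 4 ^+ n)%:C * (4 ^+ n * W z j)%:C =
     (W z j / c)%:C * (h z - H (e ^+ j)).
    rewrite !rmorphM !fmorphV /=; field.
    by rewrite !fmorph_eq0 expf_neq0 ?pnatr_eq0//= gt_eqF.
  rewrite modulusM modulus_real ger0_norm ?divr_ge0 ?(ltW c0)// modulusB.
  by rewrite ler_wpM2l ?divr_ge0 ?(ltW c0)// HD// modulusX e1 expr1n.
have -> : \sum_(j < m) (W z j / c * (e0 / 2 + D * modulus (e ^+ j - z) ^+ 2)) =
   (\sum_(j < m) W z j) * (e0 / 2 / c) + (\sum_(j < m) W z j * modulus (e ^+ j - z) ^+ 2) * (D / c).
  rewrite !big_distrl -big_split/=; apply: eq_bigr => j _; field; exact: lt0r_neq0.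
rewrite Wc// Wm//.
have -> : c * (e0 / 2 / c) + 2 * c / n.+1%:R * (D / c) = e0 / 2 + 2 * D / n.+1%:R.
  have : n.+1%:R != 0 :> R by rewrite pnatr_eq0.
  by move: (n.+1%:R : R) => k k0; field; rewrite k0 lt0r_neq0.
by rewrite [leRHS]splitr lerD2l.
Qed.

End Density.

(** * Continuous functions on proper compact subsets of the circle *)

Section ContinuousOnCompact.
Variable R : realType.
Implicit Types (x z w zeta : R[i]).

Lemma within_continuous_modulus (K : set (Cplx R)) (h : Cplx R -> Cplx R) z (e : R) :
  {within K, continuous h} -> K z -> 0 < e ->
  exists2 d, 0 < d & forall x, K x -> modulus (z - x) < d -> modulus (h z - h x) <= e.
Proof.
move=> /subspace_continuousP hc Kz e0.
have e0C : 0 < e%:C :> R[i] by rewrite ltcR.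
have /cvgrPdist_le /(_ _ e0C) := hc _ Kz.
move=> /nbhs_normP[d /= d0 dP].
have dE : d = (Re d)%:C by rewrite RRe_real// gtr0_real.
exists (Re d); first by rewrite -ltcR -dE.
move=> x Kx zx; have := dP x; rewrite /= dE normE ltcR => /(_ zx Kx).
by rewrite normE lecR.
Qed.

Lemma compact_uniform_modulus (K : set (Cplx R)) (h : Cplx R -> Cplx R) (e : R) :
  compact K -> {within K, continuous h} -> 0 < e ->
  exists2 d, 0 < d & forall x z, K x -> K z -> modulus (x - z) < d -> modulus (h x - h z) <= e.
Proof.
move=> /compact_near_coveringP Kc hc e0.
have e20 : 0 < e / 2 by rewrite divr_gt0.
have [|n _ nP] := Kc nat \oo (fun n x => K x -> forall z, K z -> modulus (x - z) < n.+1%:R^-1 ->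
   modulus (h x - h z) <= e) _.
  move=> x0 Kx0; have [d d0 dP] := within_continuous_modulus hc Kx0 e20.
  have d20 : 0 < d / 2 by rewrite divr_gt0.
  have d2C : 0 < (d / 2)%:C :> R[i] by rewrite ltcR.
  pose n0 := Num.bound (d / 2)^-1.
  exists (ball_ Num.norm x0 (d / 2)%:C, [set n | (n0 <= n)%N]).
    by split; [exact: nbhs_ball_norm (PosNum d2C) | exists n0].
  case=> x n /= []; rewrite normE ltcR => x0x n0n Kx z Kz xz.
  have nd : n.+1%:R^-1 <= d / 2.
    rewrite -[leRHS]invrK lef_pV2 ?posrE ?invr_gt0//.
    apply: le_trans (ltW (archi_boundP _)) _; first by rewrite invr_ge0 ltW.
    by rewrite ler_nat (leq_trans n0n).
  rewrite [leRHS]splitr; apply: le_trans (modulus_triangle _ (h x0) _) _.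
  have d2d : d / 2 < d by rewrite ltr_pdivrMr// ltr_pMr// ltr1n.
  apply: lerD; first by rewrite modulusB dP// (lt_trans x0x).
  apply: dP => //; apply: le_lt_trans (modulus_triangle _ x _) _.
  by rewrite [ltRHS]splitr ltrD// (lt_le_trans xz).
exists n.+1%:R^-1; first by rewrite invr_gt0.
by move=> x z Kx Kz xz; apply: (nP n (leqnn n) x Kx).
Qed.

Lemma compact_modulus_bounded (K : set (Cplx R)) (h : Cplx R -> Cplx R) :
  compact K -> {within K, continuous h} -> exists B, forall x, K x -> modulus (h x) <= B.
Proof.
move=> /compact_near_coveringP Kc hc.
have [|n _ nP] := Kc nat \oo (fun n x => K x -> modulus (h x) <= n%:R) _.
  move=> x0 Kx0; have [d d0 dP] := within_continuous_modulus hc Kx0 ltr01.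
  have dC : 0 < d%:C :> R[i] by rewrite ltcR.
  pose n0 := (Num.bound (modulus (h x0))).+1.
  exists (ball_ Num.norm x0 d%:C, [set n | (n0 <= n)%N]).
    by split; [exact: nbhs_ball_norm (PosNum dC) | exists n0].
  case=> x n /= []; rewrite normE ltcR => x0x n0n Kx.
  rewrite -[h x](subrK (h x0)) (le_trans (modulusD _ _))//.
  apply: (@le_trans _ _ n0%:R); last by rewrite ler_nat.
  rewrite /n0 -addn1 natrD addrC lerD//; first exact/ltW/archi_boundP/modulus_ge0.
  by rewrite modulusB dP.
by exists n%:R => x Kx; exact: (nP n (leqnn n) x Kx).
Qed.

(** [H] is [h] precomposed with an approximate nearest-point map to [K]; it
    replaces a continuous extension of [h]. *)
Lemma nearest_point_extension (K : set (Cplx R)) (h : Cplx R -> Cplx R) (e : R) :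
  compact K -> {within K, continuous h} -> 0 < e ->
  exists (H : R[i] -> R[i]) (D : R), forall zeta z, K z ->
     modulus (H zeta - h z) <= e + D * modulus (zeta - z) ^+ 2.
Proof.
move=> Kc hc e0.
have [d d0 dP] := compact_uniform_modulus Kc hc e0.
have [B BP] := compact_modulus_bounded Kc hc.
have [[k Kk]|K0] := pselect (exists k, K k); last first.
  by exists (fun=> 0), 0 => zeta z Kz; case: K0; exists z.
have B0 : 0 <= B by apply: le_trans (BP _ Kk); exact: modulus_ge0.
have near zeta : exists y, K y /\ forall z, K z -> modulus (y - zeta) <= modulus (z - zeta) + d / 2.
  pose E := [set modulus (z - zeta) | z in K].
  have E_inf : has_inf E.
    by split; [exists (modulus (k - zeta)), k | exists 0 => _ [z _ <-]; exact: modulus_ge0].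
  have [_ [y Ky <-] yP] := inf_adherent (divr_gt0 d0 (ltr0n R 2)) E_inf.
  exists y; split=> // z Kz; apply: (le_trans (ltW yP)); rewrite lerD2r.
  by apply: ge_inf; [exact: E_inf.2 | exists z].
have [pi piP] := choice near.
exists (h \o pi), (32 * B / d ^+ 2) => zeta z Kz /=.
have [Kpi pin] := piP zeta; have pz := pin z Kz.
have D0 : 0 <= 32 * B / d ^+ 2 * modulus (zeta - z) ^+ 2.
  by rewrite mulr_ge0 ?sqr_ge0// divr_ge0 ?sqr_ge0// mulr_ge0.
have [lt_d|ge_d] := ltP (modulus (pi zeta - z)) d.
  by rewrite (le_trans (dP _ _ Kpi Kz lt_d))// lerDl.
have zd : d / 4 <= modulus (zeta - z).
  by have := modulus_triangle (pi zeta) zeta z; rewrite (modulusB z) in pz; lra.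
apply: (@le_trans _ _ (2 * B)).
  apply: le_trans (modulusD _ _) _; rewrite modulusN.
  by have := BP _ Kpi; have := BP _ Kz; lra.
rewrite ler_wpDl ?(ltW e0)//.
have zd2 : (d / 4) ^+ 2 <= modulus (zeta - z) ^+ 2 by rewrite lerXn2r ?nnegrE ?modulus_ge0 ?divr_ge0// ltW.
apply: (@le_trans _ _ (32 * B / d ^+ 2 * (d / 4) ^+ 2)); last first.
  by rewrite ler_wpM2l// divr_ge0 ?sqr_ge0// mulr_ge0.
rewrite (_ : 32 * B / d ^+ 2 * (d / 4) ^+ 2 = 2 * B)//.
by field; rewrite gt_eqF.
Qed.

(** Polynomials are dense among the continuous functions on a compact subset of
    a gapped circle. *)
Lemma continuous_poly_approx (K : set (Cplx R)) (h : Cplx R -> Cplx R) w (delta : R) :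
  compact K -> {within K, continuous h} ->
  0 < delta -> modulus w = 1 -> K `<=` gapped_circle w delta -> poly_approx K h.
Proof.
move=> Kc hc delta0 w1 KL; apply: (kernel_approximation delta0 w1 KL) => e e0.
have [H [D HD]] := nearest_point_extension Kc hc e0.
by exists H, D => zeta z _; exact: HD.
Qed.

(** A proper compact subset of the circle misses a gap around one of countably
    many points. *)
Lemma proper_compact_gap (K : set (Cplx R)) : proper_compact K ->
  exists (q : rat) (k : nat), K `<=` gapped_circle (cayley (ratr q : R)) k.+1%:R^-1.
Proof.
case=> Kc KT KnT.
have [w0 w01 Kw0] : exists2 w0 : Cplx R, modulus w0 = 1 & ~ K w0.
  apply: contrapT => nex; apply: KnT; apply/seteqP; split=> // z.
  rewrite /unit_circle /= normE => -[z1]; apply: contrapT => Kz; apply: nex; by exists z.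
have Kcl : closed K by apply: compact_closed => //; exact: norm_hausdorff.
have : nbhs w0 (~` K) by apply: open_nbhs_nbhs; split; [exact: closed_openC|].
move=> /nbhs_normP[d /= d0 dP].
have dE : d = (Re d)%:C by rewrite RRe_real// gtr0_real.
set d1 := Re d in dE; have d10 : 0 < d1 by rewrite -ltcR -dE.
have Kd z : K z -> d1 <= modulus (w0 - z).
  move=> Kz; rewrite leNgt; apply/negP => zw; apply: (dP z) => //=.
  by rewrite dE normE ltcR.
(* the missing point [w0] may be 1, which is only a limit of the Cayley curve *)
have [t tw] : exists t : R, modulus (w0 - cayley t) <= d1 / 4.
  have [->|w0n1] := eqVneq w0 1; last first.
    by have [t ->] := cayley_surj w01 w0n1; exists t; rewrite subrr modulus0 divr_ge0// ltW.
  exists (8 / d1); rewrite modulusB.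
  have c0 : 0 < 8 / d1 by rewrite divr_gt0.
  apply: le_trans (cayley_near1 c0) _.
  by rewrite invf_div mulrA le_eqVlt; apply/orP; left; apply/eqP; field.
have [q /andP[q1 q2]] : exists q : rat, t < ratr q < t + d1 / 8.
  have tq : t < t + d1 / 8 by rewrite ltrDl divr_gt0.
  by have [q] := rat_in_itvoo tq; rewrite in_itv /=; exists q.
pose n0 := Num.bound (d1 / 2)^-1; exists q, n0 => z Kz.
split; first by have := KT _ Kz; rewrite /unit_circle /= normE => -[].
apply: (@le_trans _ _ (d1 / 2)).
  rewrite -[leRHS]invrK lef_pV2 ?posrE ?invr_gt0 ?divr_gt0//.
  apply: le_trans (ltW (archi_boundP _)) _; first by rewrite invr_ge0 divr_ge0 ?ltW.
  by rewrite ler_nat.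
have := cayley_lipschitz t (ratr q); have := Kd z Kz.
have := modulus_triangle w0 (cayley t) z; have := modulus_triangle (cayley t) (cayley (ratr q)) z.
have : `|t - ratr q| <= d1 / 8 by rewrite ler_norml; apply/andP; split; lra.
rewrite (modulusB z); lra.
Qed.

End ContinuousOnCompact.

(** * Construction of the universal function *)

Section Construction.
Variable R : realType.
Implicit Types (x t e : R) (z w zeta : R[i]) (p S : {poly R[i]}).

(** The polynomials with coefficients in Q(i), encoded by the lists of the real
    and imaginary parts of their coefficients. *)
Definition rational_poly (s : seq (rat * rat)) : {poly R[i]} :=
  Poly [seq (ratr c.1 : R) +i* (ratr c.2 : R) | c <- s].

Lemma rational_approx x e : 0 < e -> exists q : rat, `|x - ratr q| <= e.
Proof.
move=> e0; have xe : x < x + e by rewrite ltrDl.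
have [q] := rat_in_itvoo xe; rewrite in_itv /= => /andP[q1 q2]; exists q.
by rewrite ler_norml; apply/andP; split; lra.
Qed.

Lemma rational_poly_dense p e : 0 < e -> exists s : seq (rat * rat),
  forall z, modulus z <= 1 -> modulus (p.[z] - (rational_poly s).[z]) <= e.
Proof.
elim/poly_ind : p e => [|p c IHp] e e0.
  by exists [::] => z _; rewrite /rational_poly /= !horner0 subrr modulus0 ltW.
have [s sP] := IHp (e / 2) (divr_gt0 e0 (ltr0n _ 2)).
have e4 : 0 < e / 4 by rewrite divr_gt0.
have [a aP] := rational_approx (Re c) e4; have [b bP] := rational_approx (Im c) e4.
exists ((a, b) :: s) => z z1.
have -> : rational_poly ((a, b) :: s) = rational_poly s * 'X + ((ratr a : R) +i* (ratr b : R))%:P.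
  by rewrite /rational_poly /= cons_poly_def.
rewrite !hornerE.
have -> : p.[z] * z + c - ((rational_poly s).[z] * z + ((ratr a : R) +i* (ratr b : R))) =
  (p.[z] - (rational_poly s).[z]) * z + (c - ((ratr a : R) +i* (ratr b : R))) by ring.
apply: le_trans (modulusD _ _) _; rewrite modulusM.
have i1 : modulus (p.[z] - (rational_poly s).[z]) * modulus z <= e / 2.
  by apply: le_trans (sP z z1); rewrite ler_piMr ?modulus_ge0.
have i2 := modulus_le_ReIm (c - ((ratr a : R) +i* (ratr b : R))).
by case: c aP bP i2 => c1 c2 /=; lra.
Qed.

Lemma poly_radial_lipschitz p : exists2 C, 0 <= C & forall x z, 0 <= x <= 1 ->
  modulus z <= 1 -> modulus (p.[x%:C * z] - p.[z]) <= C * (1 - x).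
Proof.
elim/poly_ind : p => [|p c [C C0 CP]].
  by exists 0 => // x z _ _; rewrite !horner0 subrr modulus0 mul0r.
have [B B0 BP] := poly_bounded p 1.
exists (C + B) => [|x z x01 z1]; first exact: addr_ge0.
have /andP[x0 x1] := x01.
have E v : (p * 'X + c%:P).[v] = p.[v] * v + c by rewrite !hornerE.
rewrite !E.
have -> : p.[x%:C * z] * (x%:C * z) + c - (p.[z] * z + c) =
  (p.[x%:C * z] - p.[z]) * (x%:C * z) + p.[z] * ((x - 1)%:C * z) by rewrite rmorphB; ring.
apply: le_trans (modulusD _ _) _; rewrite [leRHS]mulrDl !modulusM !modulus_real.
rewrite (ger0_norm x0) distrC (ger0_norm (_ : 0 <= 1 - x)) ?subr_ge0//.
apply: lerD.
  apply: le_trans (CP x z x01 z1); rewrite ler_piMr ?modulus_ge0//.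
  by rewrite mulr_ile1 ?modulus_ge0.
rewrite ler_pM ?modulus_ge0 ?BP ?mulr_ge0 ?modulus_ge0 ?subr_ge0//.
by rewrite ler_piMr ?subr_ge0.
Qed.

Lemma Re_ge_sub z w e : modulus (z - w) <= e -> Re w - e <= Re z.
Proof.
move=> zw; have := Re_le_modulus (z - w); rewrite complex_ReD complex_ReN ler_norml => /andP[]; lra.
Qed.

(** Inductive step: [S] is modified into a polynomial close to [p] on a gapped
    circle of any radius [r] close enough to 1. On the segment from 0 to 1 the new
    polynomial is almost a convex combination of [S] and [p], which preserves
    lower bounds of real parts; the condition at 1 bounds [Re p] from below near
    1, and farther from 1 the polynomial hardly changes. *)
Lemma approximation_step S p (q delta a e c : R) : 0 < delta -> 0 <= a < 1 -> 0 < e -> 1 <= c ->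
  (forall x, 0 <= x <= 1 -> - c <= Re S.[x%:C]) -> 0 <= Re p.[1] ->
  exists2 r0, r0 < 1 & forall r, r0 < r <= 1 -> exists S' : {poly R[i]}, [/\
    forall z, modulus z <= a -> modulus (S'.[z] - S.[z]) <= e,
    forall z, gapped_circle (cayley q) delta z ->
      modulus (S'.[r%:C * z] - p.[r%:C * z]) <= e &
    forall x, 0 <= x <= 1 -> - (c + e) <= Re S'.[x%:C] ].
Proof.
move=> delta0 /andP[a0 a1] e0 c1 Sc p1.
have [C C0 CP] := poly_radial_lipschitz p.
pose a' := Num.max a (1 - (C + 1)^-1).
have C1 : 0 < C + 1 by rewrite ltr_pwDr.
have aa' : a <= a' by rewrite le_max lexx.
have a'1 : a' < 1 by rewrite gt_max a1 gtrBl invr_gt0.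
have a'0 : 0 <= a' by apply: le_trans aa'.
have px x : 0 <= x <= 1 -> a' <= x -> -1 <= Re p.[x%:C].
  move=> x01 a'x; have := CP x 1 x01; rewrite modulus1 lexx mulr1 => /(_ isT).
  move=> /Re_ge_sub; apply: le_trans.
  have : 1 - x <= (C + 1)^-1 by move: a'x; rewrite ge_max => /andP[_]; lra.
  move=> /(ler_wpM2l C0); have : C / (C + 1) <= 1 by rewrite ler_pdivrMr// mul1r lerDl.
  lra.
exists a' => // r /andP[a'r r1].
have [B1 B10 SB] := poly_bounded S 1; have [B2 B20 pB] := poly_bounded p 1.
pose M := B1 + B2 + 1; have M0 : 0 < M by rewrite /M; lra.
have SpM z : modulus z <= 1 -> modulus (p.[z] - S.[z]) <= M.
  move=> z1; apply: le_trans (modulusD _ _) _; rewrite modulusN.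
  by have := SB z z1; have := pB z z1; rewrite /M; lra.
have eM0 : 0 < e / M by rewrite divr_gt0.
have small v z : modulus v <= e / M -> modulus z <= 1 -> modulus (v * (p.[z] - S.[z])) <= e.
  move=> v1 z1; rewrite modulusM -[leRHS](divfK (lt0r_neq0 M0)).
  by rewrite ler_pM ?modulus_ge0 ?SpM.
have r0 : 0 <= r by apply: le_trans (ltW a'r).
have [u [ua uG ux]] := @cutoff R q delta a' r (e / M) delta0 ltac:(by rewrite a'0) r1 eM0.
pose S' := S + u * (p - S); exists S'.
have S'E z : S'.[z] = S.[z] + u.[z] * (p.[z] - S.[z]) by rewrite /S' !hornerE.
have S'a z : modulus z <= a' -> modulus (S'.[z] - S.[z]) <= e.
  move=> za; rewrite S'E addrAC subrr add0r small//; first exact: ua.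
  exact: le_trans (ltW a'1).
split=> [z za|z zG|x x01].
- exact/S'a/(le_trans za).
- have rz1 : modulus (r%:C * z) <= 1.
    by rewrite modulusM zG.1 mulr1 modulus_real ger0_norm.
  have -> : S'.[r%:C * z] - p.[r%:C * z] =
      (u.[r%:C * z] - 1) * (p.[r%:C * z] - S.[r%:C * z]) by rewrite S'E; ring.
  by rewrite small// uG.
- have /andP[x0 x1] := x01; have Sx := Sc x x01.
  have [xa|ax] := leP x a'.
    have := S'a x%:C; rewrite modulus_real ger0_norm// => /(_ xa) /Re_ge_sub; lra.
  have [t /andP[t0 t1] ut] := ux x x01.
  have x1C : modulus (x%:C) <= 1 by rewrite modulus_real ger0_norm.
  have := small _ _ ut x1C.
  have -> : (u.[x%:C] - t%:C) * (p.[x%:C] - S.[x%:C]) =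
     S'.[x%:C] - ((1 - t)%:C * S.[x%:C] + t%:C * p.[x%:C]) by rewrite S'E rmorphB; ring.
  move/Re_ge_sub; rewrite complex_ReD !complex_ReMl; have := px x x01 (ltW ax); nra.
Qed.

End Construction.

Section Universal.
Variables (R : realType) (r : nat -> R).
Hypotheses (r_incr : increasing_seq r) (r_01 : forall n, 0 <= r n < 1)
  (r_cvg : r @ \oo --> (1 : R)).
Implicit Types (x t e : R) (z w zeta : R[i]) (p S : {poly R[i]}).

Lemma radii_large x N : x < 1 -> exists2 n, (N < n)%N & x < r n.
Proof.
move=> x1; have x10 : 0 < (1 - x) / 2 by rewrite divr_gt0 ?subr_gt0.
move/cvgrPdist_le : r_cvg => /(_ _ x10) [n0 _ H].
exists (maxn n0 N.+1); first exact: leq_maxr.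
by have := H (maxn n0 N.+1) (leq_maxl _ _); rewrite /= ler_norml => /andP[]; lra.
Qed.

(** A task [(p, q, k)] asks for the approximation of the polynomial [p] on the
    circle with a gap of radius [1 / k.+1] around the point [cayley q]. *)
Definition task : Type := ({poly R[i]} * rat * nat)%type.

Definition task_circle (t : task) : set R[i] :=
  gapped_circle (cayley (ratr t.1.2 : R)) t.2.+1%:R^-1.

(** The inductive steps, chained so as to treat the tasks one after the other.
    The lower bound -2 comes from the bounds [- (2 - 1 / 2 ^+ n)] of the stages. *)
Lemma task_sequence (t : nat -> task) : (forall n, 0 <= Re (t n).1.1.[1]) ->
  exists (S : nat -> {poly R[i]}) (m : nat -> nat), forall n, [/\ (m n < m n.+1)%N,
    forall z, modulus z <= r (m n) -> modulus ((S n.+1).[z] - (S n).[z]) <= 1 / 2 ^+ n.+1,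
    forall z, task_circle (t n) z -> modulus ((S n.+1).[(r (m n.+1))%:C * z] -
       (t n).1.1.[(r (m n.+1))%:C * z]) <= 1 / 2 ^+ n.+1 &
    forall x, 0 <= x <= 1 -> -2 <= Re (S n).[x%:C] ].
Proof.
move=> t1.
pose inv n (st : {poly R[i]} * nat) :=
  forall x, 0 <= x <= 1 -> - (2 - 1 / 2 ^+ n) <= Re st.1.[x%:C].
pose next n (st st' : {poly R[i]} * nat) := [/\ (st.2 < st'.2)%N,
    forall z, modulus z <= r st.2 -> modulus (st'.1.[z] - st.1.[z]) <= 1 / 2 ^+ n.+1,
    forall z, task_circle (t n) z -> modulus (st'.1.[(r st'.2)%:C * z] -
       (t n).1.1.[(r st'.2)%:C * z]) <= 1 / 2 ^+ n.+1 &
    inv n.+1 st'].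
have half n : 1 / 2 ^+ n = 1 / 2 ^+ n.+1 + 1 / 2 ^+ n.+1 :> R.
  by rewrite exprS invfM; field.
have step (nst : nat * ({poly R[i]} * nat)) : exists st', inv nst.1 nst.2 -> next nst.1 nst.2 st'.
  case: nst => n [S m] /=.
  have [ok|nok] := pselect (inv n (S, m)); last by exists (S, m).
  have c1 : 1 <= 2 - 1 / 2 ^+ n :> R.
    have : 1 / 2 ^+ n <= 1 :> R by rewrite ler_pdivrMr ?exprn_gt0// mul1r exprn_ege1// ler1n.
    lra.
  have d0 : 0 < (t n).2.+1%:R^-1 :> R by rewrite invr_gt0.
  have e0 : 0 < 1 / 2 ^+ n.+1 :> R by rewrite divr_gt0 ?exprn_gt0.
  have [r0 r01 r0P] := approximation_step (ratr (t n).1.2) d0 (r_01 m) e0 c1 ok (t1 n).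
  have [m' mm' rm'] := radii_large m r01.
  have [|S' [Sa SG Sx]] := r0P (r m'); first by rewrite rm' ltW//; case/andP: (r_01 m').
  exists (S', m') => _; split => // x x01.
  by apply: le_trans (Sx x x01); rewrite /= (half n); lra.
have [F FP] := choice step.
pose st := fix st n := if n is n'.+1 then F (n', st n') else (0 : {poly R[i]}, 0%N).
have stP n : inv n (st n).
  elim: n => [x _|n IHn] /=; last by have [] := FP (n, st n) IHn.
  by rewrite horner0 /=; lra.
exists (fun n => (st n).1), (fun n => (st n).2) => n.
have [a b c _] := FP (n, st n) (stP n); split => // x x01.
by apply: le_trans (stP n x x01); rewrite lerN2 gerBl divr_ge0 ?exprn_ge0.
Qed.

(** On each gapped circle, dilates of [f] with arbitrarily large index approximate
    the rational polynomials whose value at 1 has nonnegative real part. *)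
Definition half_universal (f : Cplx R -> Cplx R) : Prop :=
  forall (s : seq (rat * rat)) (q : rat) (k N : nat) e,
    0 <= Re (rational_poly R s).[1] -> 0 < e ->
    exists2 m, (N <= m)%N & forall z, gapped_circle (cayley (ratr q : R)) k.+1%:R^-1 z ->
      modulus (f ((r m)%:C * z) - (rational_poly R s).[z]) <= e.

(** The tasks given by rational polynomials are enumerated in such a way that
    each of them is repeated infinitely often. *)
Lemma universal_function : exists f : Cplx R -> Cplx R, [/\ holomorphic_disc f,
    forall x, 0 <= x < 1 -> -2 <= Re (f x%:C) & half_universal f].
Proof.
(* the first component of the decoded list takes each value infinitely often *)
pose decode n : option (seq (rat * rat) * rat * nat) := unpickle (nth 0%N (CodeSeq.decode n) 0).
pose t n : task := if decode n is Some (s, q, k) then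
    (if 0 <= Re (rational_poly R s).[1] then rational_poly R s else 0, q, k)
  else (0, 0, 0%N).
have t1 n : 0 <= Re (t n).1.1.[1].
  rewrite /t; case: (decode n) => [[[s q] k]|]; last by rewrite horner0.
  by case: ifP => //=; rewrite horner0.
have [S [m SmP]] := task_sequence t1.
have m_mono : {homo m : i j / (i <= j)%N}.
  by apply: homo_leq => // [? ? ?|i]; [exact: leq_trans | have [/ltnW] := SmP i].
have m_ge n : (n <= m n)%N.
  by elim: n => // n IHn; have [mm _ _ _] := SmP n; apply: leq_ltn_trans mm.
have rm_mono : {homo (fun n => r (m n)) : i j / (i <= j)%N >-> i <= j}.
  by move=> i j ij; rewrite r_incr m_mono.
have rm1 x : x < 1 -> exists n, x < r (m n).
  move=> /(radii_large 0)[n _ xn]; exists n; apply: lt_le_trans xn _.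
  by rewrite r_incr.
have [f f_hol fS] := poly_limit_holomorphic rm_mono rm1
  (fun n => let: And4 _ b _ _ := SmP n in b).
exists f; split => // [x /andP[x0 x1]|s q k N e s1 e0].
  have [n0 xn0] := rm1 x x1.
  apply: (@le_half_powers R _ _ 2) => j.
  have xj : modulus x%:C <= r (m (n0 + j)%N).
    rewrite modulus_real ger0_norm// (le_trans (ltW xn0))//; apply: rm_mono; exact: leq_addr.
  have := fS _ _ xj; rewrite modulusB => /Re_ge_sub.
  have [_ _ _ /(_ x)] := SmP (n0 + j)%N; rewrite x0 ltW// => /(_ isT) i1.
  have : 2 / 2 ^+ (n0 + j) <= 2 / 2 ^+ j :> R.
    by rewrite ler_pM2l// lef_pV2 ?posrE ?exprn_gt0// ler_eXn2l ?ltr1n// leq_addl.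
  lra.
have [C C0 CP] := poly_radial_lipschitz (rational_poly R s).
have C1 : 0 < C + 1 by rewrite ltr_pwDr.
have e20 : 0 < e / 2 by rewrite divr_gt0.
have [N1 _ rN1] : exists2 N1, (0 < N1)%N & 1 - e / 2 / (C + 1) < r N1.
  by apply: radii_large; rewrite gtrBl divr_gt0.
have e60 : 0 <= 3 / (e / 2) by rewrite divr_ge0// ltW.
pose N2 := Num.bound (3 / (e / 2)).
pose j := maxn N (maxn N1 N2).
pose n := CodeSeq.code [:: pickle (s, q, k); j].
have jn : (j < n)%N by have := CodeSeq.ltn_code [:: pickle (s, q, k); j]; rewrite /= => /and3P[].
have tn : t n = (rational_poly R s, q, k).
  by rewrite /t /decode /n CodeSeq.codeK /= pickleK s1.
have nm : (n < m n.+1)%N by exact: leq_trans (m_ge n.+1).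
exists (m n.+1); first by rewrite (leq_trans _ (ltnW nm))// (leq_trans _ (ltnW jn))// leq_maxl.
move=> z zG; have [z1 _] := zG.
have [_ _ + _] := SmP n; rewrite tn => /(_ z zG) /= a1.
have /andP[rm0 rmlt1] := r_01 (m n.+1).
have a2 : modulus (f ((r (m n.+1))%:C * z) - (S n.+1).[(r (m n.+1))%:C * z]) <= 2 / 2 ^+ n.+1.
  by rewrite modulusB; apply: fS; rewrite modulusM z1 mulr1 modulus_real ger0_norm.
have a3 : modulus ((rational_poly R s).[(r (m n.+1))%:C * z] - (rational_poly R s).[z]) <= e / 2.
  have r01' : 0 <= r (m n.+1) <= 1 by rewrite rm0 ltW.
  have z1' : modulus z <= 1 by rewrite z1.
  apply: le_trans (CP _ _ r01' z1') _.
  have : r N1 <= r (m n.+1).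
    by rewrite r_incr (leq_trans _ (ltnW nm))// (leq_trans _ (ltnW jn))// !leq_max leqnn !orbT.
  move=> rr; have : 1 - r (m n.+1) <= e / 2 / (C + 1) by lra.
  move=> /(ler_wpM2l C0) i; apply: (le_trans i).
  by rewrite mulrCA ler_piMr ?(ltW e20)// ler_pdivrMr// mul1r lerDl.
have a4 : 3 / 2 ^+ n.+1 <= e / 2.
  rewrite ler_pdivrMr ?exprn_gt0// [_ * _ ^+ _]mulrC -ler_pdivrMr//.
  apply: (le_trans (ltW (archi_boundP e60))); rewrite -natrX ler_nat.
  apply: ltnW; apply: leq_ltn_trans (ltn_expl n.+1 (isT : 1 < 2)%N).
  by rewrite leqW// (leq_trans _ (ltnW jn))// !leq_max leqnn !orbT.
have i1 := modulus_triangle (f ((r (m n.+1))%:C * z)) (S n.+1).[(r (m n.+1))%:C * z] (rational_poly R s).[z].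
have i2 := modulus_triangle (S n.+1).[(r (m n.+1))%:C * z] (rational_poly R s).[(r (m n.+1))%:C * z] (rational_poly R s).[z].
have -> : e = e / 2 + e / 2 by rewrite -splitr.
by move: a4; rewrite (_ : 3 / 2 ^+ n.+1 = 2 / 2 ^+ n.+1 + 1 / 2 ^+ n.+1) -?mulrDl; lra.
Qed.

End Universal.

(** * Uniform convergence and universality *)

Section Universality.
Variable R : realType.
Implicit Types (K : set (Cplx R)) (f g h : Cplx R -> Cplx R).

Lemma uniform_nbhs_modulus K h (P : set (Cplx R -> Cplx R)) :
  nbhs (h : {uniform` K -> Cplx R}) P <->
  exists2 e : R, 0 < e & forall g, (forall z, K z -> modulus (h z - g z) < e) -> P g.
Proof.
rewrite uniform_nbhs; split=> [[E [entE EP]]|[e e0 eP]].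
  move: entE; rewrite -entourage_ballE => -[d /= d0 dE].
  have dR : d = (Re d)%:C by rewrite RRe_real// gtr0_real.
  exists (Re d); first by rewrite -ltcR -dR.
  move=> g gh; apply: EP => z Kz; apply: dE; rewrite /= -ball_normE /=.
  by rewrite dR normE ltcR gh.
exists [set xy | ball xy.1 e%:C xy.2]; split.
  by rewrite -entourage_ballE; exists e%:C => //=; rewrite ltcR.
move=> g /= gh; apply: eP => z Kz; have := gh z Kz.
by rewrite -ball_normE /= normE ltcR.
Qed.

Lemma uniform_closureP K (S : set (Cplx R -> Cplx R)) h :
  closure (S : set {uniform` K -> Cplx R}) h <->
  (forall e : R, 0 < e -> exists2 g, S g & forall z, K z -> modulus (h z - g z) < e).
Proof.
split=> [Sh e e0|He B /uniform_nbhs_modulus[e e0 eB]].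
  have [] := Sh [set g | forall z, K z -> modulus (h z - g z) < e].
    by apply/uniform_nbhs_modulus; exists e.
  by move=> g [Sg gh]; exists g.
by have [g Sg gh] := He e e0; exists g; split => //; exact: eB.
Qed.

Lemma uniform_cvgP K (u : nat -> Cplx R -> Cplx R) h :
  {uniform K, u @ \oo --> h} <-> (forall e : R, 0 < e ->
    exists N, forall n, (N <= n)%N -> forall z, K z -> modulus (h z - u n z) < e).
Proof.
split=> [uh e e0|He B /uniform_nbhs_modulus[e e0 eB]].
  have [] := uh [set g | forall z, K z -> modulus (h z - g z) < e].
    by apply/uniform_nbhs_modulus; exists e.
  by move=> N _ NP; exists N => n Nn; exact: NP.
by have [N NP] := He e e0; exists N => // n Nn; apply: eB; exact: NP.
Qed.

Lemma proper_compact1 : proper_compact [set (1 : Cplx R)].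
Proof.
split; first exact: compact_set1.
- by move=> _ ->; rewrite /unit_circle /= normr1.
- move/seteqP => [_ /(_ (-1 : Cplx R))]; rewrite /unit_circle /= normrN normr1 => /(_ erefl).
  by move/eqP; rewrite eqNr oner_eq0.
Qed.

(** A function which stays away from a constant on the radius ending at 1 is not
    universal: take [K = {1}]. *)
Lemma not_universal (r : nat -> R) f (c : R[i]) : (forall n, 0 <= r n < 1) ->
  (forall x : R, 0 <= x < 1 -> 1 <= modulus (c - f x%:C)) ->
  ~ rho_abel_universal r f /\ ~ abel_universal f.
Proof.
move=> r01 fc; have cc : {within [set (1 : Cplx R)], continuous (fun=> c : Cplx R)}.
  by apply: continuous_subspaceT; exact: (@cst_continuous (Cplx R) (Cplx R) c).
split=> [/(_ _ proper_compact1 _ cc)|/(_ _ _ proper_compact1 cc)[rho [rho01 _]]].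
  move=> /uniform_closureP/(_ 1 ltr01)[_ [n _ <-] /(_ 1 erefl)].
  by rewrite /dilate mulr1 ltNge fc ?r01.
move=> /uniform_cvgP/(_ 1 ltr01)[N /(_ N (leqnn N) 1 erefl)].
by rewrite /dilate mulr1 ltNge fc ?rho01.
Qed.

Lemma rational_polyN (s : seq (rat * rat)) :
  rational_poly R [seq (- c.1, - c.2) | c <- s] = - rational_poly R s.
Proof.
rewrite /rational_poly; elim: s => [|c s IHs] /=; first by rewrite oppr0.
rewrite !cons_poly_def IHs opprD mulNr; congr (_ + _); rewrite -polyCN; congr (_%:P).
by rewrite !rmorphN.
Qed.

Section WithRadii.
Variable r : nat -> R.
Hypotheses (r_incr : increasing_seq r) (r_01 : forall n, 0 <= r n < 1)
  (r_cvg : r @ \oo --> (1 : R)).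

(** Some dilate of [g], with an index at least [N], is [e]-close to [h] on [K]. *)
Definition approximates g K h (e : R) (N : nat) :=
  exists2 m, (N <= m)%N & forall z, K z -> modulus (h z - dilate g (r m) z) < e.

(** Approximation at all accuracies yields an increasing sequence of radii. *)
Lemma approximates_sequence g K h :
  (forall (e : R) N, 0 < e -> approximates g K h e N) ->
  exists rho : nat -> R, [/\ increasing_seq rho, (forall n, 0 < rho n < 1),
    rho @ \oo --> (1 : R) & {uniform K, (fun n => dilate g (rho n)) @ \oo --> h}].
Proof.
move=> gh.
have step (jm : nat * nat) : exists m, (jm.2 < m)%N /\
    forall z, K z -> modulus (h z - dilate g (r m) z) < jm.1.+1%:R^-1.
  by have [|m Nm mP] := gh jm.1.+1%:R^-1 jm.2.+1; [rewrite invr_gt0 | exists m].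
have [F FP] := choice step.
pose m := fix m n := if n is n'.+1 then F (n, m n') else F (0, 0)%N.
have mS n : (m n < m n.+1)%N by have [] := FP (n.+1, m n).
have mP n z : K z -> modulus (h z - dilate g (r (m n)) z) < n.+1%:R^-1.
  by case: n => [|n]; [have [_] := FP (0, 0)%N | have [_] := FP (n.+1, m n)]; apply.
have m_ge n : (n < m n)%N.
  by elim: n => [|n IHn]; [have [] := FP (0, 0)%N | apply: leq_ltn_trans (mS n)].
exists (r \o m); split.
- by apply/increasing_seqP => n /=; rewrite (leW_mono r_incr); exact: mS.
- move=> n /=; have /andP[_ ->] := r_01 (m n); rewrite andbT.
  have /andP[r0 _] := r_01 0%N; apply: le_lt_trans r0 _.
  by rewrite (leW_mono r_incr); exact: leq_ltn_trans (m_ge n).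
- apply: cvg_comp r_cvg; move=> A [N _ NA]; exists N => // n /= Nn; apply: NA => /=.
  exact: leq_trans Nn (ltnW (m_ge n)).
- apply/uniform_cvgP => e e0; exists (Num.bound e^-1) => n Nn z Kz /=.
  apply: lt_le_trans (mP n z Kz) _; rewrite -[leRHS]invrK lef_pV2 ?posrE ?invr_gt0//.
  apply: le_trans (ltW (archi_boundP _)) _; first by rewrite invr_ge0 ltW.
  by rewrite ler_nat leqW.
Qed.

(** A rational polynomial close to [h], or its opposite, has a value at 1 with
    nonnegative real part. *)
Lemma approximates_or_opp f K h (e : R) N :
  half_universal r f -> proper_compact K -> {within K, continuous h} -> 0 < e ->
  approximates f K h e N \/ approximates (fun z => - f z) K h e N.
Proof.
move=> fP Kpc hc e0; have [q [k KG]] := proper_compact_gap Kpc.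
have [Kc KT _] := Kpc.
have k0 : 0 < k.+1%:R^-1 :> R by rewrite invr_gt0.
have e4 : 0 < e / 4 by rewrite divr_gt0.
have [p pP] := continuous_poly_approx Kc hc k0 (modulus_cayley _) KG e4.
have [s sP] := rational_poly_dense p e4.
have hs z : K z -> modulus (h z - (rational_poly R s).[z]) <= e / 2.
  move=> Kz; apply: le_trans (modulus_triangle _ p.[z] _) _.
  by have := pP z Kz; have := sP z (gapped_circle_bounded (KG z Kz)); lra.
have [s0|s0] := leP 0 (Re (rational_poly R s).[1]).
  left; have [m Nm mP] := fP s q k N _ s0 e4; exists m => // z Kz.
  apply: le_lt_trans (modulus_triangle _ (rational_poly R s).[z] _) _.
  rewrite [X in _ + X]modulusB.
  by apply: le_lt_trans (lerD (hs z Kz) (mP z (KG z Kz))) _; lra.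
have s'0 : 0 <= Re (rational_poly R [seq (- c.1, - c.2) | c <- s]).[1].
  by rewrite rational_polyN hornerN complex_ReN oppr_ge0 ltW.
right; have [m Nm mP] := fP _ q k N _ s'0 e4; exists m => // z Kz.
apply: le_lt_trans (modulus_triangle _ (rational_poly R s).[z] _) _.
have := mP z (KG z Kz); rewrite rational_polyN hornerN opprK addrC => mz.
rewrite /dilate opprK; apply: le_lt_trans (lerD (hs z Kz) mz) _; lra.
Qed.

End WithRadii.
End Universality.

Theorem theorem5p6 (R : realType) (r : nat -> R)
    (r_incr : increasing_seq r)
    (r_01 : forall n, 0 <= r n < 1)
    (r_cvg : r @ \oo --> (1 : R)) :
  (exists f1 f2 : Cplx R -> Cplx R,
     [/\ holomorphic_disc f1, holomorphic_disc f2,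
         rho_abel_multi_universal r [set f1; f2],
         ~ rho_abel_universal r f1 & ~ rho_abel_universal r f2])
  /\
  (exists f1 f2 : Cplx R -> Cplx R,
     [/\ holomorphic_disc f1, holomorphic_disc f2,
         abel_multi_universal [set f1; f2],
         ~ abel_universal f1 & ~ abel_universal f2]).
Proof.
have [f [f_hol f_re fP]] := universal_function r_incr r_01 r_cvg.
pose g : Cplx R -> Cplx R := fun z => - f z.
have g_hol : holomorphic_disc g by move=> z /f_hol fz; exact: derivableN.
have [f_rho f_abel] : ~ rho_abel_universal r f /\ ~ abel_universal f.
  apply: (@not_universal R r f (-3)) => // x /f_re fx.
  apply: le_trans (Re_le_modulus _); rewrite complex_ReD !complex_ReN -normrN.
  by apply: le_trans (ler_norm _); rewrite /=; lra.
have [g_rho g_abel] : ~ rho_abel_universal r g /\ ~ abel_universal g.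
  apply: (@not_universal R r g 3) => // x /f_re fx.
  apply: le_trans (Re_le_modulus _); rewrite /g opprK complex_ReD.
  by apply: le_trans (ler_norm _); rewrite /=; lra.
split; exists f, g; split => // K.
- move=> Kpc h hc; apply/uniform_closureP => e e0.
  have [[m _ mP]|[m _ mP]] := approximates_or_opp 0 fP Kpc hc e0.
    by exists (dilate f (r m)) => //; exists f; [left | exists m].
  by exists (dilate g (r m)) => //; exists g; [right | exists m].
- move=> h Kpc hc.
  have {}hc : {within K, continuous h} by case: Kpc => _ KT _; exact: continuous_subspaceW hc.
  have [fh|] := pselect (forall (e : R) N, 0 < e -> approximates r f K h e N).
    by exists f; [left | exact: approximates_sequence fh].
  move=> /existsNP[e1 /existsNP[N1 /not_implyP[e10 nf]]].
  (* beyond the accuracy [e1] and the index [N1], only the opposite can work *)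
  exists g; first by right.
  apply: approximates_sequence => // e N e0.
  have ee : 0 < Num.min e e1 by rewrite lt_min e0.
  have [[m Nm mP]|[m Nm mP]] := approximates_or_opp (maxn N N1) fP Kpc hc ee.
    case: nf; exists m; first by rewrite (leq_trans _ Nm)// leq_maxr.
    by move=> z Kz; apply: lt_le_trans (mP z Kz) _; rewrite ge_min lexx orbT.
  exists m; first by rewrite (leq_trans _ Nm)// leq_maxl.
  by move=> z Kz; apply: lt_le_trans (mP z Kz) _; rewrite ge_min lexx.
Qed.
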